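(* Let $I$ be an HN ideal of $A=k[x_1,x_2,x_3]$ and let $m(I)=(m_1(I),m_2(I),m_3(I))$ be its associated integer vector. Let $\mathfrak{q}\in\operatorname{Min}(A/I)$. Then, for all $i,j\in\{1,2,3\}$ with $i\neq j$, $$e(x_i;A_{\mathfrak{m}}/\mathfrak{q}_{\mathfrak{m}})\geq \frac{m_i(I)}{\gcd(m_i(I),m_j(I))}.$$ In particular, setting $d=\gcd(m_1(I),m_2(I),m_3(I))$ and $s=\min\{\gcd(m_i(I),m_j(I))\mid 1\leq i<j\leq 3\}$, $$\operatorname{cardinal}\operatorname{Min}(A/I)\leq 1+\frac{s(d-1)}{d}.$$
   Context: $k$ is a field, $A=k[x_1,x_2,x_3]$ is the polynomial ring in three variables, $\mathfrak{m}=(x_1,x_2,x_3)$, $\mathbb{N}$ denotes the positive integers. An HN (Herzog-Northcott) ideal of $A$ is an ideal $I=(v_1,v_2,D)$ with $v_1=x_1^{c_1}-x_2^{b_2}x_3^{a_3}$, $v_2=x_2^{c_2}-x_1^{a_1}x_3^{b_3}$, $D=x_3^{c_3}-x_1^{b_1}x_2^{a_2}$, where $a=(a_1,a_2,a_3),b=(b_1,b_2,b_3)\in\mathbb{N}^3$ and $c=(c_1,c_2,c_3)=a+b$. The integer vector associated to $I$ is $m(I)=(m_1(I),m_2(I),m_3(I))$, where $m_i(I)=\operatorname{length}(A/(x_iA+I))$ (finite, since each $x_iA+I$ is $\mathfrak{m}$-primary). $\operatorname{Min}(A/I)$ is the set of minimal primes of $I$ (viewed as primes of $A$). $e(x_i;A_{\mathfrak{m}}/\mathfrak{q}_{\mathfrak{m}})$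 is the Hilbert-Samuel multiplicity of the ideal generated by $x_i$ in the local ring $A_{\mathfrak{m}}/\mathfrak{q}A_{\mathfrak{m}}$. *)

(* Defs.v *)
From HB Require Import structures.
From mathcomp Require Import all_boot all_order all_algebra.
From mathcomp Require Import ring_quotient fraction.
From mathcomp Require Import boolp classical_sets cardinality.
From mathcomp Require Import mpoly.

Set Implicit Arguments.
Unset Strict Implicit.
Unset Printing Implicit Defensive.

Import GRing.Theory.
Local Open Scope classical_set_scope.
Local Open Scope quotient_scope.
Local Open Scope ring_scope.

Section Ideals.
Variable R : comPzRingType.
Implicit Types I J S P : set R.

Definition is_ideal I : Prop :=
  [/\ I 0, forall x y, I x -> I y -> I (x + y) & forall a x, I x -> I (a * x)].

Definition is_prime P : Prop :=
  [/\ is_ideal P, ~ P 1 & forall x y, P (x * y) -> P x \/ P y].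

Definition ideal_gen S : set R :=
  [set x | forall I, is_ideal I -> S `<=` I -> I x].

(* The power J ^ n; for n = 0 the empty product gives the whole ring. *)
Definition ideal_pow J (n : nat) : set R :=
  ideal_gen [set x | exists2 f : 'I_n -> R, forall i, J (f i) & x = \prod_i f i].

Definition minimal_primes I : set (set R) :=
  [set q | [/\ is_prime q, I `<=` q &
    forall p, is_prime p -> I `<=` p -> p `<=` q -> p = q]].

Lemma ideal_gen_ideal S : is_ideal (ideal_gen S).
Proof.
split=> [I [] //|x y gx gy I iI sI|a x gx I iI sI]; case: (iI) => I0 ID IM.
  by apply: ID; [apply: gx|apply: gy].
by apply: IM; apply: gx.
Qed.

(* C 0 < C 1 < ... < C n, a chain of length n, that is, with n + 1 terms *)
Definition has_chain (Q : set (set R)) (n : nat) : Prop :=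
  exists C : nat -> set R,
    (forall i, (i <= n)%N -> Q (C i)) /\ (forall i, (i < n)%N -> C i `<` C i.+1).

Definition longest_chain (Q : set (set R)) (n : nat) : Prop :=
  has_chain Q n /\ forall m, has_chain Q m -> (m <= n)%N.

End Ideals.

Section QuotientRing.
Variables (R : comPzRingType) (S : set R).

Definition ideal_gen_pred : {pred R} := fun x => `[< ideal_gen S x >].

Lemma ideal_gen_predP x : reflect (ideal_gen S x) (x \in ideal_gen_pred).
Proof. exact: asboolP. Qed.

Lemma ideal_gen_pred_zmod : zmod_closed ideal_gen_pred.
Proof.
have [i0 iD iM] := ideal_gen_ideal S.
split; first exact/ideal_gen_predP.
move=> x y /ideal_gen_predP gx /ideal_gen_predP gy; apply/ideal_gen_predP.
by apply: iD => //; rewrite -mulN1r; apply: iM.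
Qed.

HB.instance Definition _ :=
  GRing.isZmodClosed.Build R ideal_gen_pred ideal_gen_pred_zmod.

(* The ring R / (S).  The library's {ideal_quot _} only covers proper ideals,
   so the product is added here to its additive quotient; the zero ring is
   allowed. *)
Definition quot_ring := Quotient.quot (ideal_gen_pred : zmodClosed R).

HB.instance Definition _ := Choice.on quot_ring.
HB.instance Definition _ := GRing.Zmodule.on quot_ring.

Definition quot_pi (x : R) : quot_ring := \pi_(quot_ring) x.

Lemma quot_pi_eq x y : quot_pi x = quot_pi y <-> ideal_gen S (x - y).
Proof.
split=> [e|g].
  by apply/ideal_gen_predP; rewrite Quotient.idealrBE; apply/eqP.
by apply/eqP; rewrite -[_ == _]Quotient.idealrBE; apply/ideal_gen_predP.
Qed.

Lemma quot_pi_repr (u : quot_ring) : quot_pi (repr u) = u.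
Proof. exact: reprK. Qed.

Lemma quot_piD x y : quot_pi (x + y) = quot_pi x + quot_pi y.
Proof. exact: (raddfD (\pi_quot_ring)). Qed.

Definition quot_one : quot_ring := quot_pi 1.
Definition quot_mul (u v : quot_ring) : quot_ring := quot_pi (repr u * repr v).

Lemma quot_pi_mul x y : quot_mul (quot_pi x) (quot_pi y) = quot_pi (x * y).
Proof.
have [i0 iD iM] := ideal_gen_ideal S; apply/quot_pi_eq.
set x' := repr _; set y' := repr _.
have gx : ideal_gen S (x' - x) by apply/quot_pi_eq; rewrite quot_pi_repr.
have gy : ideal_gen S (y' - y) by apply/quot_pi_eq; rewrite quot_pi_repr.
have -> : x' * y' - x * y = y' * (x' - x) + x * (y' - y).
  by rewrite !mulrBr [y' * x']mulrC [y' * x]mulrC addrA subrK.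
by apply: iD; apply: iM.
Qed.

Lemma quot_mulA : associative quot_mul.
Proof.
move=> u v w; rewrite -(quot_pi_repr u) -(quot_pi_repr v) -(quot_pi_repr w).
by rewrite !quot_pi_mul mulrA.
Qed.

Lemma quot_mulC : commutative quot_mul.
Proof. by move=> u v; rewrite /quot_mul mulrC. Qed.

Lemma quot_mul1 : left_id quot_one quot_mul.
Proof. by move=> u; rewrite -(quot_pi_repr u) quot_pi_mul mul1r. Qed.

Lemma quot_mulDl : left_distributive quot_mul +%R.
Proof.
move=> u v w; rewrite -(quot_pi_repr u) -(quot_pi_repr v) -(quot_pi_repr w).
by rewrite -quot_piD !quot_pi_mul mulrDl quot_piD.
Qed.

HB.instance Definition _ := GRing.Zmodule_isComPzRing.Build quot_ring
  quot_mulA quot_mulC quot_mul1 quot_mulDl.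

End QuotientRing.

Section Invariants.

(* The submodules of the R-module R / (S) are the ideals of the ring R / (S),
   so length (R / (S)) is the length of the longest chains of such ideals. *)
Definition is_length (R : comPzRingType) (S : set R) (n : nat) : Prop :=
  longest_chain (@is_ideal (quot_ring S)) n.

(* length (R / (S)); takes the value 0 if the length is infinite *)
Definition length_quot (R : comPzRingType) (S : set R) : nat :=
  xget 0%N (is_length S).

Definition is_krull_dim (R : comPzRingType) (d : nat) : Prop :=
  longest_chain (@is_prime R) d.

(* For large n, length (R / J ^ n) = P n with P of degree d = dim R, and
   e (J; R) = d! times the leading coefficient of P. *)
Definition is_multiplicity (R : comPzRingType) (J : set R) (e : rat) : Prop :=
  exists (d : nat) (P : {poly rat}) (N : nat),
    [/\ is_krull_dim R d, size P = d.+1,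
        forall n, (N <= n)%N ->
          exists2 l, is_length (ideal_pow J n) l & P.[n%:R] = l%:R
      & e = (d`!)%:R * lead_coef P].

(* e (J; R); takes the value 0 if it is undefined *)
Definition multiplicity (R : comPzRingType) (J : set R) : rat :=
  xget 0 (is_multiplicity J).

End Invariants.

(* The indices 1, 2, 3 *)
Notation ix1 := (@Ordinal 3 0 isT).
Notation ix2 := (@Ordinal 3 1 isT).
Notation ix3 := (@Ordinal 3 2 isT).

Section ThreeVariables.
Variable k : fieldType.
Local Notation A := {mpoly k[3]}.
Local Notation "x %:F" := (@FracField.tofrac _ x).

Definition maxid : set A := ideal_gen [set f | exists i : 'I_3, f = 'X_i].

Lemma maxidP (f : A) : maxid f <-> f@_0%MM = 0.
Proof.
split=> [mf|f0].
  apply: (mf [set g : A | g@_0%MM = 0]) => [|g [i ->]] /=.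
    split=> /= [|g h g0 h0|a g g0]; first by rewrite mcoeff0.
      by rewrite mcoeffD g0 h0 addr0.
    rewrite (rmorphM (mcoeff 0%MM)) /= g0 mulr0 //.
  by rewrite mcoeffX mnm1_eq0.
move=> I [I0 ID IM] XI; rewrite [f]mpolyE; elim/big_ind: _ => // m _.
have [->|m0] := eqVneq m 0%MM; first by rewrite f0 scale0r.
have [i mi] : exists i, m i != 0%N.
  apply/existsP; apply: contraNT m0; rewrite negb_exists => /forallP h.
  by apply/eqP/mnmP=> i; rewrite mnm0E; apply/eqP; rewrite -[_ == _]negbK.
have -> : m = ((m - U_(i)) + U_(i))%MM.
  by rewrite submK // lep1mP.
rewrite mpolyXD scalerAl; apply: IM; apply: XI; by exists i.
Qed.

(* The local ring A_m, as the ring of fractions f / g with g not in m inside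
   the field of fractions of the domain A. *)
Definition in_locA : {pred {fraction A}} :=
  fun x => `[< exists f g : A, ~ maxid g /\ x = f%:F / g%:F >].

Lemma in_locAP x :
  reflect (exists f g : A, ~ maxid g /\ x = f%:F / g%:F) (x \in in_locA).
Proof. exact: asboolP. Qed.

Lemma maxid_neq0 (g : A) : ~ maxid g -> g%:F != 0.
Proof.
by move=> mg; apply/eqP=> /eqP; rewrite tofrac_eq0 => /eqP g0; apply: mg;
  apply/maxidP; rewrite g0 mcoeff0.
Qed.

Lemma maxidM (g h : A) : ~ maxid g -> ~ maxid h -> ~ maxid (g * h).
Proof.
move=> mg mh /maxidP; rewrite (rmorphM (mcoeff 0%MM)) /= => /eqP.
by rewrite mulf_eq0 => /orP[/eqP/maxidP|/eqP/maxidP].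
Qed.

Lemma in_locA_subring : subring_closed in_locA.
Proof.
split=> [|x y /in_locAP[f [g [mg ->]]] /in_locAP[f' [g' [mg' ->]]]
         |x y /in_locAP[f [g [mg ->]]] /in_locAP[f' [g' [mg' ->]]]];
  apply/in_locAP.
- exists 1, 1; split; last by rewrite tofrac1 divr1.
  by move/maxidP/eqP; rewrite mcoeff1 eqxx oner_eq0.
- exists (f * g' - f' * g), (g * g'); split; first exact: maxidM.
  rewrite -mulNr addf_div ?maxid_neq0 //.
  by rewrite tofracB !tofracM mulNr.
- exists (f * f'), (g * g'); split; first exact: maxidM.
  by rewrite mulf_div !tofracM.
Qed.

HB.instance Definition _ :=
  GRing.isSubringClosed.Build {fraction A} in_locA in_locA_subring.

Record locA := LocA { locA_val : {fraction A}; _ : locA_val \in in_locA }.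

HB.instance Definition _ := [isSub for locA_val].
HB.instance Definition _ := [Choice of locA by <:].
HB.instance Definition _ := [SubChoice_isSubComNzRing of locA by <:].

Lemma to_locA_subproof (f : A) : f%:F \in in_locA.
Proof.
apply/in_locAP; exists f, 1; split; last by rewrite tofrac1 divr1.
by move/maxidP/eqP; rewrite mcoeff1 eqxx oner_eq0.
Qed.

Definition to_locA (f : A) : locA := LocA (to_locA_subproof f).

(* A_m / q A_m *)
Definition local_quot (q : set A) : comPzRingType := quot_ring (to_locA @` q).

Definition to_local_quot (q : set A) (f : A) : local_quot q :=
  quot_pi (to_locA @` q) (to_locA f).

(* e (x_i; A_m / q A_m) *)
Definition mult_x (i : 'I_3) (q : set A) : rat :=
  multiplicity (ideal_gen [set to_local_quot q 'X_i]).

Definition HN_ideal (a b : 'I_3 -> nat) : set A :=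
  let c i := (a i + b i)%N in
  let v1 : A := 'X_ix1 ^+ c ix1 - 'X_ix2 ^+ b ix2 * 'X_ix3 ^+ a ix3 in
  let v2 : A := 'X_ix2 ^+ c ix2 - 'X_ix1 ^+ a ix1 * 'X_ix3 ^+ b ix3 in
  let D : A := 'X_ix3 ^+ c ix3 - 'X_ix1 ^+ b ix1 * 'X_ix2 ^+ a ix2 in
  ideal_gen [set v1; v2; D].

Definition is_HN (I : set A) : Prop :=
  exists a b : 'I_3 -> nat,
    [/\ forall i, (0 < a i)%N, forall i, (0 < b i)%N & I = HN_ideal a b].

(* m_i(I) = length (A / (x_i A + I)) *)
Definition mvec (I : set A) (i : 'I_3) : nat := length_quot ('X_i |` I).

End ThreeVariables.

(* Main.v *)
(* Put w = m(I)/d.  The three binomials rewrite every monomial, modulo I and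
   without changing its w-degree, into x_i^t times one of m_i monomials in the
   other two variables, which form a staircase; this gives
   length A/(x_i A + I) = m_i.  A minimal prime q of I is w-homogeneous (the
   largest homogeneous ideal contained in q is a prime containing I) and
   contains no variable.

   Multiplicity: A_m/q_m is a one-dimensional domain, so e(x_i) is
   r = dim A/(q + x_i A).  Monomials of minimal w-degree in each residue class
   modulo w_i are independent modulo q + x_i A, since q is homogeneous without
   monomials.  Hence r >= w_i = m_i/d, which is at least m_i/gcd(m_i, m_j).

   Number of minimal primes: take a homogeneous f_l lying in every q_l' except
   q_l, and multiply by monomials to reach a common degree n.  The products are
   independent modulo I, so there are at most as many q_l as staircase
   monomials of degree congruent to n modulo w_i.  Summing over the w_i classes
   gives card Min(A/I) * w_i <= m_i = d w_i, hence card Min(A/I) <= d, and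
   d <= 1 + s(d-1)/d because d <= s. *)
Require Import Defs.
From HB Require Import structures.
From mathcomp Require Import all_boot all_order all_algebra.
From mathcomp Require Import ring_quotient fraction.
From mathcomp Require Import boolp classical_sets functions cardinality.
From mathcomp Require Import mpoly ring zify.

Set Implicit Arguments.
Unset Strict Implicit.
Unset Printing Implicit Defensive.

Import Order.TTheory GRing.Theory Num.Theory.
Local Open Scope classical_set_scope.
Local Open Scope ring_scope.

(** * Ideals *)

Section IdealTheory.
Variables (R : comPzRingType) (K : set R).
Hypothesis idK : is_ideal K.

Lemma ideal0 : K 0. Proof. by case: idK. Qed.

Lemma idealD x y : K x -> K y -> K (x + y).
Proof. by case: idK => _ + _; apply. Qed.

Lemma ideal_mull a x : K x -> K (a * x).
Proof. by case: idK => _ _; apply. Qed.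

Lemma ideal_mulr a x : K x -> K (x * a).
Proof. by rewrite mulrC; apply: ideal_mull. Qed.

Lemma idealN x : K x -> K (- x).
Proof. by rewrite -mulN1r; apply: ideal_mull. Qed.

Lemma idealB x y : K x -> K y -> K (x - y).
Proof. by move=> Kx Ky; apply: idealD => //; apply: idealN. Qed.

Lemma idealBC x y : K (x - y) -> K (y - x).
Proof. by move=> /idealN; rewrite opprB. Qed.

Lemma ideal_trans y x z : K (x - y) -> K (y - z) -> K (x - z).
Proof. by move=> h1 h2; have := idealD h1 h2; rewrite addrA subrK. Qed.

Lemma ideal_subl x y : K (x - y) -> K y -> K x.
Proof. by move=> h1 h2; have := idealD h1 h2; rewrite subrK. Qed.

Lemma ideal_sum (T : Type) (r : seq T) (P : pred T) (F : T -> R) :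
  (forall t, P t -> K (F t)) -> K (\sum_(t <- r | P t) F t).
Proof. by move=> KF; elim/big_ind: _ => //; [exact: ideal0|exact: idealD]. Qed.

Lemma ideal_prod (T : finType) (F : T -> R) t : K (F t) -> K (\prod_s F s).
Proof. by move=> KF; rewrite (bigD1 t) //=; apply: ideal_mulr. Qed.

End IdealTheory.

Lemma primeX (R : comPzRingType) (p : set R) x n : is_prime p -> p (x ^+ n) -> p x.
Proof.
case=> _ p1 pM; elim: n => [|n IHn]; first by rewrite expr0.
by rewrite exprS => /pM [].
Qed.

Lemma ideal_gen_sub (R : comPzRingType) (S K : set R) :
  is_ideal K -> S `<=` K -> ideal_gen S `<=` K.
Proof. by move=> idK SK x; apply. Qed.

Lemma sub_ideal_gen (R : comPzRingType) (S : set R) : S `<=` ideal_gen S.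
Proof. by move=> x Sx K _; apply. Qed.

Lemma ideal_gen_id (R : comPzRingType) (K : set R) : is_ideal K -> ideal_gen K = K.
Proof.
move=> idK; apply/seteqP; split; [exact: ideal_gen_sub|exact: sub_ideal_gen].
Qed.

Lemma preimage_ideal (R R' : comPzRingType) (phi : {rmorphism R -> R'}) (K : set R') :
  is_ideal K -> is_ideal (phi @^-1` K).
Proof.
move=> idK; split=> [|x y|a x] /=; rewrite ?rmorph0 ?rmorphD ?rmorphM.
- exact: ideal0.
- exact: idealD.
- exact: ideal_mull.
Qed.

Lemma preimage_prime (R R' : comPzRingType) (phi : {rmorphism R -> R'}) (p : set R') :
  is_prime p -> is_prime (phi @^-1` p).
Proof.
case=> idp p1 pM; split; [exact: preimage_ideal|by rewrite /= rmorph1|].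
by move=> x y /=; rewrite rmorphM; apply: pM.
Qed.

Lemma is_ideal0 (R : comPzRingType) : is_ideal [set 0 : R].
Proof.
by split=> [//|x y -> ->|a x ->] /=; rewrite ?addr0 ?mulr0.
Qed.

Lemma longest_chain_unique (R : comPzRingType) (Q : set (set R)) n m :
  longest_chain Q n -> longest_chain Q m -> n = m.
Proof.
move=> [cn len] [cm lem]; apply/eqP.
by rewrite eqn_leq; apply/andP; split; [apply: lem|apply: len].
Qed.

Section QuotPi.
Variables (R : comPzRingType) (S : set R).

Lemma quot_pi_zmod_morphism : zmod_morphism (@quot_pi R S).
Proof. exact: (raddfB (\pi_(quot_ring S))%qT). Qed.

Lemma quot_pi_monoid_morphism : monoid_morphism (@quot_pi R S).
Proof. by split=> [//|x y]; rewrite -quot_pi_mul. Qed.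

HB.instance Definition _ :=
  GRing.isZmodMorphism.Build R (quot_ring S) (@quot_pi R S) quot_pi_zmod_morphism.
HB.instance Definition _ :=
  GRing.isMonoidMorphism.Build R (quot_ring S) (@quot_pi R S) quot_pi_monoid_morphism.

Lemma quot_pi_eq0 x : quot_pi S x = 0 <-> ideal_gen S x.
Proof. by rewrite -(rmorph0 (quot_pi S)) quot_pi_eq subr0. Qed.

End QuotPi.

(** * Linear independence modulo an ideal *)

Section LinearAlgebra.
Variables (k : fieldType) (n : nat).
Local Notation A := {mpoly k[n]}.
Variable K : set A.
Hypothesis idK : is_ideal K.

Lemma idealZ (c : k) f : K f -> K (c *: f).
Proof. by rewrite -mul_mpolyC; apply: ideal_mull. Qed.

Lemma idealZ_inv (c : k) f : c != 0 -> K (c *: f) -> K f.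
Proof. by move=> c0 /(idealZ c^-1); rewrite scalerA mulVf // scale1r. Qed.

(** Generation and linear independence over [k] of classes in A/K, expressed on representatives in
    A. *)
Definition spanned (S : finType) (e : S -> A) (f : A) : Prop :=
  exists c : S -> k, K (f - \sum_s c s *: e s).

Definition independent (S : finType) (e : S -> A) : Prop :=
  forall c : S -> k, K (\sum_s c s *: e s) -> forall s, c s = 0.

Section Spanned.
Variables (S : finType) (e : S -> A).

Lemma spannedD f g : spanned e f -> spanned e g -> spanned e (f + g).
Proof.
move=> [c Kc] [d Kd]; exists (fun s => c s + d s).
have -> : \sum_s (c s + d s) *: e s = \sum_s c s *: e s + \sum_s d s *: e s.
  by rewrite -big_split; apply: eq_bigr => s _; rewrite scalerDl.
by rewrite opprD addrACA; apply: idealD.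
Qed.

Lemma spannedZ a f : spanned e f -> spanned e (a *: f).
Proof.
move=> [c Kc]; exists (fun s => a * c s).
have -> : \sum_s (a * c s) *: e s = a *: \sum_s c s *: e s.
  by rewrite scaler_sumr; apply: eq_bigr => s _; rewrite scalerA.
by rewrite -scalerBr; apply: idealZ.
Qed.

Lemma spanned_ideal f : K f -> spanned e f.
Proof.
by move=> Kf; exists (fun=> 0); rewrite big1 ?subr0 // => s _; rewrite scale0r.
Qed.

Lemma spanned_mem s f : K (f - e s) -> spanned e f.
Proof.
move=> Kf; exists (fun t => (t == s)%:R); rewrite (bigD1 s) //= eqxx scale1r.
by rewrite big1 ?addr0 // => t /negPf ->; rewrite scale0r.
Qed.

Lemma spanned_sum (T : Type) (r : seq T) (P : pred T) (F : T -> A) :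
  (forall t, P t -> spanned e (F t)) -> spanned e (\sum_(t <- r | P t) F t).
Proof.
move=> sF; elim/big_ind: _ => //; last exact: spannedD.
exact: spanned_ideal (ideal0 idK).
Qed.

Lemma spanned_msupp f : (forall m, m \in msupp f -> spanned e 'X_[m]) -> spanned e f.
Proof.
move=> sf; rewrite [f]mpolyE big_seq; apply: spanned_sum => m mf.
exact/spannedZ/sf.
Qed.

End Spanned.

(** If [T] were larger than [S], the coefficient matrix of the [t j] in terms of [e] would have a
    nonzero left kernel vector, whose entries give a relation between the [t j] modulo [K]. *)
Lemma dim_le (S T : finType) (e : S -> A) (t : T -> A) :
  (forall j, spanned e (t j)) -> independent t -> (#|T| <= #|S|)%N.
Proof.
move=> /boolp.choice [C KC] ind; rewrite leqNgt; apply/negP => ltST.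
pose M := \matrix_(i < #|T|, j < #|S|) C (enum_val i) (enum_val j).
have /rowV0Pn [u /sub_kermxP uM u0] : kermx M != 0.
  rewrite -mxrank_eq0 mxrank_ker -lt0n subn_gt0.
  exact: leq_ltn_trans (rank_leq_col M) ltST.
suff Ku : K (\sum_s u 0 (enum_rank s) *: t s).
  case/negP: u0; apply/eqP/rowP => i; rewrite mxE.
  by have := ind _ Ku (enum_val i); rewrite enum_valK.
(* The subtracted double sum vanishes because [u] kills [M]; each remaining difference lies in
   [K]. *)
have -> : \sum_s u 0 (enum_rank s) *: t s =
          \sum_s u 0 (enum_rank s) *: (t s - \sum_i C s i *: e i).
  under [RHS]eq_bigr do rewrite scalerBr.
  rewrite sumrB -[LHS]subr0; congr (_ - _); apply/esym.
  under eq_bigr do rewrite scaler_sumr.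
  rewrite exchange_big big1 //= => i _.
  under eq_bigr do rewrite scalerA.
  rewrite -scaler_suml.
  have /rowP/(_ (enum_rank i)) := uM; rewrite !mxE.
  rewrite (reindex enum_rank) /=; last exact/onW_bij/enum_rank_bij.
  by under eq_bigr do rewrite mxE !enum_rankK; move=> ->; rewrite scale0r.
by apply: ideal_sum => // s _; apply: idealZ.
Qed.

(** A generating family of least size is a basis: a relation with [c s] nonzero would express [b s]
    by the other members, and these would already generate. *)
Lemma exists_basis (S : finType) (e : S -> A) : (forall f, spanned e f) ->
  exists r (b : 'I_r -> A), (forall f, spanned b f) /\ independent b.
Proof.
move=> spe; pose P r := `[< exists b : 'I_r -> A, forall f, spanned b f >].
have exP : exists r, P r.
  exists #|{: S}|; apply/asboolP; pose v : 'I_#|{: S}| -> S := enum_val.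
  exists (e \o v) => f; have [c Kc] := spe f; exists (c \o v).
  suff <- : \sum_s c s *: e s = \sum_i (c \o v) i *: (e \o v) i by [].
  by rewrite (reindex v) //; apply/onW_bij/enum_val_bij.
case: (ex_minnP exP) => r /asboolP [b spb] rmin; exists r, b; split=> // c Kc s.
apply/eqP; apply: contraT => cs; case: r b c s cs spb rmin Kc => [|r] b c s.
  by case: s.
move=> cs spb rmin Kc; suff /rmin : P r by rewrite ltnn.
apply/asboolP; exists (b \o lift s) => f.
have spbs u : spanned (b \o lift s) (b u).
  case: (unliftP s u) => [j ->|->].
    by apply: (@spanned_mem _ _ j); rewrite subrr; apply: ideal0.
  have -> : b s = (c s)^-1 *: (c s *: b s) by rewrite scalerA mulVf // scale1r.
  apply: spannedZ; have := Kc; rewrite (bigD1_ord s) //= => Kc'.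
  exists (fun j => - c (lift s j)).
  rewrite [X in _ - X](_ : _ = - \sum_j c (lift s j) *: b (lift s j)).
    by rewrite opprK.
  by rewrite -sumrN; apply: eq_bigr => j _; rewrite scaleNr.
have [d Kd] := spb f; rewrite -[f](subrK (\sum_s d s *: b s)).
apply: spannedD; first exact: spanned_ideal.
by apply: spanned_sum => u _; apply: spannedZ.
Qed.

End LinearAlgebra.

(** * Length and bases *)

Section Socle.
Variable k : fieldType.
Local Notation A := {mpoly k[3]}.
Variable J : set A.
Hypotheses (idJ : is_ideal J) (nilJ : forall j : 'I_3, exists M, J ('X_j ^+ M)).

(** Multiply [f] by the last power of x_j that keeps it outside [J]. The clause on [g] records that
    whatever annihilates [f] modulo [J] still annihilates [f'], so the step can be repeated for each
    variable. *)
Lemma socle_step (j : 'I_3) f : ~ J f ->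
  exists2 f', ~ J f' & J ('X_j * f') /\ forall g, J (g * f) -> J (g * f').
Proof.
move=> Jf; pose P M := `[< J ('X_j ^+ M * f) >].
have exP : exists M, P M.
  by have [M JM] := nilJ j; exists M; apply/asboolP; apply: (ideal_mulr idJ).
case: (ex_minnP exP) => -[|M] /asboolP JM Mmin; first by rewrite mul1r in JM.
exists ('X_j ^+ M * f) => [JM'|]; first by have := Mmin M (asboolT JM'); rewrite ltnn.
by split=> [|g Jg]; [rewrite mulrA -exprS|rewrite mulrCA; apply: (ideal_mull idJ)].
Qed.

(** Three steps, one per variable, produce a nonzero socle element of A/J. *)
Lemma socle f : ~ J f -> exists2 f', ~ J f' & forall u, maxid u -> J (u * f').
Proof.
move=> /(socle_step ix1) [f1 Jf1 [J1 _]].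
have [f2 Jf2 [J2 J12]] := socle_step ix2 Jf1.
have [f3 Jf3 [J3 J23]] := socle_step ix3 Jf2.
exists f3 => // u mu; apply: (mu [set u | J (u * f3)]) => [|_ [i ->]] /=.
  split=> [|x y Jx Jy|a x Jx] /=; rewrite ?mul0r ?mulrDl -?mulrA.
  - exact: (ideal0 idJ).
  - exact: (idealD idJ).
  - exact: (ideal_mull idJ).
case: i => [[|[|[|//]]] lti].
- by rewrite (_ : Ordinal lti = ix1); [apply/J23/J12|apply: val_inj].
- by rewrite (_ : Ordinal lti = ix2); [apply/J23|apply: val_inj].
- by rewrite (_ : Ordinal lti = ix3); [|apply: val_inj].
Qed.

End Socle.

(** * The maximal ideal of the origin *)

Section MaximalIdeal.
Variable k : fieldType.
Local Notation A := {mpoly k[3]}.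

Lemma maxid_ideal : is_ideal (@maxid k).
Proof. exact: ideal_gen_ideal. Qed.

Lemma maxidX i : @maxid k 'X_i.
Proof. by apply: sub_ideal_gen; exists i. Qed.

Lemma maxid_subC (f : A) : maxid (f - (f@_0%MM)%:MP).
Proof. by apply/maxidP; rewrite mcoeffB mcoeffC eqxx mulr1 subrr. Qed.

Lemma maxid_prime : is_prime (@maxid k).
Proof.
split; [exact: maxid_ideal|by move/maxidP/eqP; rewrite mcoeff1 eqxx oner_eq0|].
move=> x y mxy; apply: contrapT => /not_orP [mx my]; exact: maxidM mx my mxy.
Qed.

(** Let J = K + (g). If 1 were outside J, a nonzero socle element of A/J would be annihilated by g
    and by g - g(0), hence by the nonzero constant g(0). *)
Lemma unit_mod_primary (K : set A) (g : A) :
    is_ideal K -> (forall j : 'I_3, exists M, K ('X_j ^+ M)) -> ~ maxid g ->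
  exists h, K (g * h - 1).
Proof.
move=> idK nilK mg; pose J := [set f | exists h, K (g * h - f)].
have KJ f : K f -> J f by move=> Kf; exists 0; rewrite mulr0 sub0r; apply: idealN.
have idJ : is_ideal J.
  split=> [|x y [h Kh] [h' Kh']|a x [h Kh]].
  - exact: (KJ _ (ideal0 idK)).
  - by exists (h + h'); rewrite mulrDr opprD addrACA; apply: idealD.
  - by exists (a * h); rewrite mulrCA -mulrBr; apply: ideal_mull.
apply: contrapT => J1.
have [|f' Jf' mf'] := socle idJ _ J1.
  by move=> j; have [M KM] := nilK j; exists M; apply: KJ.
have Jgf : J (g * f') by exists f'; rewrite subrr; apply: ideal0.
have := idealB idJ Jgf (mf' _ (maxid_subC g)).
rewrite -mulrBl subKr mul_mpolyC => /(idealZ_inv idJ) h; apply/Jf'/h.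
by apply/eqP => /maxidP.
Qed.

End MaximalIdeal.

(** * Length as dimension over the field *)

Section Length.
Variables (k : fieldType) (Q : comPzRingType).
Local Notation A := {mpoly k[3]}.
Variables (phi : {rmorphism A -> Q}) (S : finType) (b : S -> A).
Local Notation K := (phi @^-1` [set 0]).
Hypotheses (phi_surj : forall y, exists f, y = phi f)
  (phi_nil : forall j, exists M, phi ('X_j ^+ M) = 0)
  (b_spans : forall f, spanned K b f) (b_indep : independent K b).

Let idK : is_ideal K. Proof. exact: preimage_ideal (is_ideal0 Q). Qed.

Lemma chain_sub m (C : nat -> set Q) : (forall i, (i < m)%N -> C i `<` C i.+1) ->
  forall i j, (i <= j <= m)%N -> C i `<=` C j.
Proof.
move=> ltC i j /andP[leij]; elim: j leij => [|j IHj].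
  by rewrite leqn0 => /eqP -> _; apply: subset_refl.
rewrite leq_eqVlt => /predU1P [<- _|leij ltjm]; first exact: subset_refl.
by apply: (subset_trans (IHj leij (ltnW ltjm))); have [] := ltC j ltjm.
Qed.

(** Elements of [C i.+1] outside [C i] are independent: in a relation modulo [K], the term of
    largest index with nonzero coefficient would lie in the smaller ideal. *)
Lemma chain_le_card m : has_chain (@is_ideal Q) m -> (m <= #|S|)%N.
Proof.
move=> [C [idC ltC]]; have subC := chain_sub ltC.
have /boolp.choice [f Cf] : forall i : 'I_m, exists f, C i.+1 (phi f) /\ ~ C i (phi f).
  move=> i; have [_ /existsNP [y /not_implyP [Cy Cy']]] := ltC i (ltn_ord i).
  by have [f yE] := phi_surj y; exists f; rewrite -yE.
rewrite -[m]card_ord; apply: (dim_le idK (e := b) (t := f)) => [j|c Kc i].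
  exact: b_spans.
apply/eqP; apply: contraT => ci.
pose j := [arg max_(j > i | c j != 0) j]; case: arg_maxnP @j => //= j cj jmax.
have [_ []] := Cf j.
have idCj : is_ideal (phi @^-1` C j) by apply/preimage_ideal/idC/ltnW.
suff CC : (phi @^-1` C j) (c j *: f j) by apply: (idealZ_inv idCj cj CC).
have := Kc; rewrite (bigD1 j) //= => Kc'.
suff Cs : (phi @^-1` C j) (\sum_(i < m | i != j) c i *: f i).
  rewrite -[c j *: f j](addrK (\sum_(i < m | i != j) c i *: f i)).
  apply: (idealB idCj) => //; rewrite /= Kc'.
  exact: ideal0 (idC _ (ltnW (ltn_ord j))).
apply: (ideal_sum idCj) => l lj; have [->|cl] := eqVneq (c l) 0.
  by rewrite scale0r; apply: ideal0.
apply: (idealZ idCj); have [Cl _] := Cf l; apply: subC Cl.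
rewrite (ltnW (ltn_ord j)) andbT ltn_neqAle.
by have := jmax l cl; rewrite /= => ->; rewrite andbT; apply: contraNneq lj => /val_inj ->.
Qed.

(** The chain grows by one line at a time: if y is a socle element modulo [C t], then C_t + k y is
    an ideal. The family [g] bounds the dimension of [C t] by [t], so this ideal is proper while [t]
    is less than [#|S|]. *)
Lemma chain_extend t : (t <= #|S|)%N ->
  exists C : nat -> set Q, [/\ forall i, (i <= t)%N -> is_ideal (C i),
    forall i, (i < t)%N -> C i `<` C i.+1 &
    exists g : 'I_t -> A, forall f, C t (phi f) -> spanned K g f].
Proof.
elim: t => [|t IHt] ltS.
  exists (fun=> [set 0]); split=> //; first by move=> i _; apply: is_ideal0.
  exists (fun=> 0) => f Kf; exact: spanned_ideal.
have [C [idC ltC [g spg]]] := IHt (ltnW ltS).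
have idCt := idC t (leqnn t).
have [f Cf] : exists f, ~ C t (phi f).
  apply/existsNP => Call; have := dim_le idK (fun s => spg _ (Call (b s))) b_indep.
  by rewrite card_ord leqNgt ltS.
have idJ : is_ideal (phi @^-1` C t) by apply: preimage_ideal.
have [|y Cy my] := socle idJ _ Cf.
  by move=> j; have [M pM] := phi_nil j; exists M; rewrite /= pM; apply: ideal0.
pose D := [set z | exists l : k, C t (z - phi (l *: y))].
have idD : is_ideal D.
  split=> [|z z' [l Cl] [l' Cl']|a z [l Cl]].
  - by exists 0; rewrite scale0r rmorph0 subrr; apply: ideal0.
  - by exists (l + l'); rewrite scalerDl rmorphD opprD addrACA; apply: idealD.
  (* Modulo [C t], the element [h] acts on the socle element through its constant term. *)
  have [h ->] := phi_surj a; exists (h@_0%MM * l).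
  rewrite -scalerA -(subrK (phi h * phi (l *: y)) (phi h * z)) -mulrBr -addrA.
  apply: idealD => //; first exact: ideal_mull.
  rewrite -rmorphM -rmorphB -[_ *: (l *: y)]mul_mpolyC -mulrBl -scalerAr.
  exact: (idealZ idJ _ (my _ (maxid_subC h))).
exists (fun i => if (i <= t)%N then C i else D); split=> [i _|i|].
- by case: ifP => // /idC.
- rewrite ltnS => leit; rewrite leit; case: ltnP => [/ltC //|leti].
  have -> : i = t by apply/eqP; rewrite eqn_leq leit.
  split=> [z Cz|/(_ (phi y)) CD]; first by exists 0; rewrite scale0r rmorph0 subr0.
  by apply/Cy/CD; exists 1; rewrite scale1r subrr; apply: ideal0.
rewrite ltnn; exists (fun i : 'I_t.+1 => if unlift ord_max i is Some j then g j else y).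
move=> h [l]; rewrite -rmorphB => /spg [c Kc].
exists (fun i => if unlift ord_max i is Some j then c j else l).
rewrite (bigD1_ord ord_max) //= !unlift_none.
under eq_bigr do rewrite liftK.
by rewrite opprD addrA.
Qed.

Lemma length_basis : longest_chain (@is_ideal Q) #|S|.
Proof.
split; last exact: chain_le_card.
by have [C [idC ltC _]] := chain_extend (leqnn #|S|); exists C.
Qed.

End Length.

(** * Weighted degrees *)

Section Grading.
Variables (k : fieldType) (w : 'I_3 -> nat).
Local Notation A := {mpoly k[3]}.

Definition wdeg (m : 'X_{1..3}) : nat := (\sum_i w i * m i)%N.

Lemma wdeg0 : wdeg 0%MM = 0%N.
Proof. by rewrite /wdeg big1 // => i _; rewrite mnm0E muln0. Qed.

Lemma wdegD m n : wdeg (m + n) = (wdeg m + wdeg n)%N.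
Proof. by rewrite -big_split; apply: eq_bigr => i _; rewrite mnmDE mulnDr. Qed.

Lemma wdegU i : wdeg U_(i) = w i.
Proof.
rewrite /wdeg (bigD1 i) //= mnm1E eqxx muln1 big1 ?addn0 // => j ji.
by rewrite mnm1E eq_sym (negPf ji) muln0.
Qed.

Lemma wdegMn m n : wdeg (m *+ n) = (wdeg m * n)%N.
Proof. by rewrite big_distrl; apply: eq_bigr => i _; rewrite mulmnE mulnA. Qed.

(* The coefficient of T^n in [grading f = f (x_i T^(w_i))] is the component of
   weighted degree n of f. *)
Definition grading : A -> {poly A} :=
  mmap (@polyC _ \o @mpolyC 3 k) (fun i => ('X_i : A)%:P * 'X^(w i)).

HB.instance Definition _ := GRing.RMorphism.on grading.

Lemma gradingX m : grading 'X_[m] = ('X_[m] : A)%:P * 'X^(wdeg m).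
Proof.
rewrite /grading mmapX /mmap1; under eq_bigr do rewrite exprMn -exprM -rmorphXn.
by rewrite big_split -expr_sum -rmorph_prod -mpolyXE_id.
Qed.

Lemma gradingZ c f : grading (c *: f) = (c%:MP)%:P * grading f.
Proof. exact: mmapZ. Qed.

Lemma coef_grading f n m : (grading f)`_n@_m = if wdeg m == n then f@_m else 0.
Proof.
elim/mpolyind: f => [|c m' p _ _ IHp]; first by rewrite rmorph0 coef0 mcoeff0 if_same.
rewrite rmorphD /= gradingZ gradingX coefD mcoeffD IHp coefCM coefCM coefXn.
rewrite mcoeffD mcoeffZ mcoeffCM mulr_natr mcoeffMn mcoeffX.
have [->|_] := eqVneq m' m; last by rewrite mul0rn mulr0 !add0r.
by rewrite eq_sym; case: eqP => _; rewrite ?mulr1n // mulr0n mulr0 addr0.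
Qed.

Lemma grading_horner1 f : (grading f).[1] = f.
Proof.
elim/mpolyind: f => [|c m p _ _ IHp]; first by rewrite rmorph0 horner0.
rewrite rmorphD /= gradingZ gradingX hornerD IHp !hornerCM hornerXn expr1n mulr1.
by rewrite mul_mpolyC.
Qed.

Lemma sum_grading f : \sum_(n < size (grading f)) (grading f)`_n = f.
Proof.
rewrite -[RHS]grading_horner1 horner_coef.
by apply: eq_bigr => i _; rewrite expr1n mulr1.
Qed.

(** An identity in A[T], so that products are handled by [grading] being a ring morphism; 0 is
    homogeneous of every degree. *)
Definition whomog n f := grading f = f%:P * 'X^n.

Lemma whomog_grading n f : whomog n (grading f)`_n.
Proof.
apply/polyP => n'; apply/mpolyP => m; rewrite coef_grading coefCM coefXn mulr_natr.
rewrite mcoeffMn !coef_grading [n' == n]eq_sym.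
have [->|nn'] := eqVneq n n'; first by rewrite mulr1n; case: eqP.
rewrite /= mulr0n.
case: (wdeg m =P n') => // mn'; case: (wdeg m =P n) nn' => // <-.
by rewrite mn' eqxx.
Qed.

Lemma whomogX m : whomog (wdeg m) 'X_[m].
Proof. exact: gradingX. Qed.

Lemma whomogC c : whomog 0 c%:MP.
Proof. by rewrite /whomog /grading mmapC expr0 mulr1. Qed.

Lemma whomogM n n' f g : whomog n f -> whomog n' g -> whomog (n + n') (f * g).
Proof. by rewrite /whomog rmorphM /= => -> ->; rewrite exprD polyCM mulrACA. Qed.

Lemma whomogB n f g : whomog n f -> whomog n g -> whomog n (f - g).
Proof. by rewrite /whomog rmorphB /= => -> ->; rewrite polyCB mulrBl. Qed.

Lemma whomog_prod (T : finType) (P : pred T) (F : T -> A) (n : T -> nat) :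
    (forall t, P t -> whomog (n t) (F t)) ->
  whomog (\sum_(t | P t) n t)%N (\prod_(t | P t) F t).
Proof.
move=> hF; apply: (big_rec2 (fun n f => whomog n f)) => [|t N f Pt]; first exact: whomogC.
exact/whomogM/hF.
Qed.

Lemma coef_homog n f n' : whomog n f -> (grading f)`_n' = if n' == n then f else 0.
Proof. by move=> ->; rewrite coefCM coefXn mulr_natr mulrb. Qed.

Lemma whomog_msupp n f m : whomog n f -> m \in msupp f -> wdeg m = n.
Proof.
move=> hf; rewrite mcoeff_msupp; have := coef_grading f (wdeg m) m.
rewrite eqxx (coef_homog _ hf); case: (eqVneq (wdeg m) n) => // _ <-.
by rewrite mcoeff0 eqxx.
Qed.

Lemma msupp_wdeg f m : m \in msupp f -> (wdeg m < size (grading f))%N.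
Proof.
rewrite mcoeff_msupp ltnNge; apply: contra => le_size.
have := coef_grading f (wdeg m) m; rewrite eqxx => <-.
by rewrite nth_default // mcoeff0.
Qed.

End Grading.

(** * Homogeneity of minimal primes *)

Section PolyPrime.
Variables (R : comNzRingType) (q : set R).
Hypothesis prq : is_prime q.

Definition poly_ext : set {poly R} := [set P | forall n, q P`_n].

(** For the least n and m at which P and P' have coefficients outside q, the coefficient of degree n
    + m of the product is congruent to P_n P'_m modulo q. *)
Lemma poly_ext_prime : is_prime poly_ext.
Proof.
have [idq q1 qM] := prq.
have idp : is_ideal poly_ext.
  split=> [n|P P' qP qP' n|P P' qP' n]; first by rewrite coef0; apply: ideal0.
    by rewrite coefD; apply: idealD.
  by rewrite coefM; apply: ideal_sum => // i _; apply: ideal_mull.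
split=> // [/(_ 0%N)|P P' qPP']; first by rewrite coef1.
apply: contrapT => /not_orP [/existsNP [n0 qn0] /existsNP [m0 qm0]].
have exP : exists n, `[< ~ q P`_n >] by exists n0; apply/asboolP.
have exP' : exists n, `[< ~ q P'`_n >] by exists m0; apply/asboolP.
case: (ex_minnP exP) (ex_minnP exP') => n /asboolP qn nmin [m /asboolP qm mmin].
have := qPP' (n + m)%N; rewrite coefM.
have ltn : (n < (n + m).+1)%N by rewrite ltnS leq_addr.
rewrite (bigD1 (Ordinal ltn)) //= addKn.
set s := \sum_(i < _ | _) _ => qs.
suff /(idealB idq qs) : q s by rewrite addrK => /qM [].
apply: (ideal_sum idq) => i; rewrite -val_eqE /= neq_ltn => /orP [lti|gti].
  apply: ideal_mulr => //; apply: contrapT => qi.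
  by have := nmin i (asboolT qi); rewrite leqNgt lti.
apply: ideal_mull => //; apply: contrapT => qi.
have := mmin _ (asboolT qi); have := ltn_ord i; move: (nat_of_ord i) gti => j; clear; lia.
Qed.

End PolyPrime.

Section HomogeneousCore.
Variables (k : fieldType) (w : 'I_3 -> nat).
Local Notation A := {mpoly k[3]}.

(** The preimage of q[T] under [grading] consists of the polynomials with all components in q. It is
    prime, contains the homogeneous generators of I and lies in q, so minimality makes it equal to
    q. *)
Lemma minimal_prime_homog (I q : set A) (G : set A) :
    I = ideal_gen G -> (forall g, G g -> exists n, whomog w n g) -> minimal_primes I q ->
  forall f, q f -> forall n, q (grading w f)`_n.
Proof.
move=> -> hG [prq Iq qmin]; have [idq _ _] := prq.
pose qh : set A := grading w @^-1` poly_ext q.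
have prqh : is_prime qh by apply/preimage_prime/poly_ext_prime.
suff qhE : qh = q by move=> f; rewrite -{1}qhE; exact.
apply: qmin => //; last first.
  by move=> f qf; rewrite -(sum_grading w f); apply: ideal_sum.
apply: ideal_gen_sub; first by case: prqh.
move=> g Gg n; have [m hg] := hG g Gg; rewrite (coef_homog _ hg).
by case: ifP => _; [exact: (Iq _ (sub_ideal_gen Gg))|exact: (ideal0 idq)].
Qed.

End HomogeneousCore.

(** * Herzog-Northcott ideals *)

Section CyclicIndices.

Lemma ord3_ind (P : 'I_3 -> Prop) : P ix1 -> P ix2 -> P ix3 -> forall i, P i.
Proof.
move=> P1 P2 P3 [[|[|[|//]]] lti].
- by rewrite (_ : Ordinal lti = ix1) //; apply: val_inj.
- by rewrite (_ : Ordinal lti = ix2) //; apply: val_inj.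
- by rewrite (_ : Ordinal lti = ix3) //; apply: val_inj.
Qed.

Lemma ordS_ix : [/\ ordS ix1 = ix2, ordS ix2 = ix3 & ordS ix3 = ix1].
Proof. by split; apply: val_inj. Qed.

Lemma ordS3 (i : 'I_3) : ordS (ordS (ordS i)) = i.
Proof. by elim/ord3_ind: i; apply: val_inj. Qed.

Lemma ordS3_neq (i : 'I_3) : ((i == ordS i) = false) * ((i == ordS (ordS i)) = false) *
  ((ordS i == i) = false) * ((ordS (ordS i) == i) = false) *
  ((ordS i == ordS (ordS i)) = false) * ((ordS (ordS i) == ordS i) = false).
Proof. by elim/ord3_ind: i. Qed.

Lemma ordS3_cases (i r : 'I_3) : [\/ r = i, r = ordS i | r = ordS (ordS i)].
Proof.
have [s1 s2 s3] := ordS_ix.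
by elim/ord3_ind: i; rewrite ?(s1, s2, s3); elim/ord3_ind: r;
  [constructor 1|constructor 2|constructor 3|constructor 3|constructor 1
  |constructor 2|constructor 2|constructor 3|constructor 1].
Qed.

Lemma mnm_ordS3P (i : 'I_3) (m m' : 'X_{1..3}) : m i = m' i -> m (ordS i) = m' (ordS i) ->
  m (ordS (ordS i)) = m' (ordS (ordS i)) -> m = m'.
Proof.
move=> e1 e2 e3; apply/mnmP => r; move: e1 e2 e3; have [s1 s2 s3] := ordS_ix.
by elim/ord3_ind: i; rewrite ?(s1, s2, s3); elim/ord3_ind: r.
Qed.

End CyclicIndices.

(** * Staircases and normal forms modulo an HN ideal *)

Section HN.
Variables (k : fieldType) (a b : 'I_3 -> nat).
Local Notation A := {mpoly k[3]}.
Local Notation I := (@HN_ideal k a b).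
Local Notation c i := (a i + b i)%N.

(** With [ordS] as cyclic successor, all three generators take the shape x_i^(c_i) -
    x_(i+1)^(b_(i+1)) x_(i+2)^(a_(i+2)), and one argument serves the three indices. *)
Definition HN_lead (i : 'I_3) : 'X_{1..3} := (U_(i) *+ c i)%MM.
Definition HN_tail (i : 'I_3) : 'X_{1..3} :=
  (U_(ordS i) *+ b (ordS i) + U_(ordS (ordS i)) *+ a (ordS (ordS i)))%MM.
Definition HN_gen (i : 'I_3) : A := 'X_[HN_lead i] - 'X_[HN_tail i].

Lemma HN_idealE : I = ideal_gen (range HN_gen).
Proof.
have [s1 s2 s3] := ordS_ix.
rewrite /HN_ideal; congr ideal_gen; apply/seteqP; split=> [f|_ [i _ <-]].
  move=> [[|]|] ->; [exists ix1|exists ix2|exists ix3] => //;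
  rewrite /HN_gen /HN_lead /HN_tail ?(s1, s2, s3) mpolyXD -!mpolyXn //.
    by rewrite [X in _ - X]mulrC.
rewrite /HN_gen /HN_lead /HN_tail mpolyXD -!mpolyXn.
elim/ord3_ind: i; rewrite ?(s1, s2, s3).
- by left; left.
- by left; right; rewrite [X in _ - X]mulrC.
- by right.
Qed.

Lemma HN_is_ideal : is_ideal I.
Proof. exact: ideal_gen_ideal. Qed.

Lemma HN_gen_in i : I (HN_gen i).
Proof. by rewrite HN_idealE; apply: sub_ideal_gen; exists i. Qed.

Lemma HN_shift (u m m' : 'X_{1..3}) : (m <= u)%MM -> I ('X_[m] - 'X_[m']) ->
  I ('X_[u] - 'X_[(u - m + m')%MM]).
Proof.
move=> le_mu Im; rewrite mpolyXD -{1}(submK le_mu) mpolyXD -mulrBr.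
exact: ideal_mull HN_is_ideal _ _ Im.
Qed.

(** The number of staircase monomials, shown in [mvecE] to be m_i(I). *)
Definition HN_mult (i : 'I_3) : nat :=
  (b (ordS i) * c (ordS (ordS i)) + a (ordS i) * a (ordS (ordS i)))%N.

(** With these numbers as weights of the variables, the three binomials are homogeneous. *)
Lemma HN_mult_balance i : (c i * HN_mult i =
  b (ordS i) * HN_mult (ordS i) + a (ordS (ordS i)) * HN_mult (ordS (ordS i)))%N.
Proof. by rewrite /HN_mult !ordS3; ring. Qed.

(** An L-shaped region in the exponents of x_(i+1) and x_(i+2), cut at exponent b_(i+1) into two
    disjoint rectangles. *)
Definition stair_index (i : 'I_3) : finType :=
  ('I_(b (ordS i)) * 'I_(c (ordS (ordS i))) + 'I_(a (ordS i)) * 'I_(a (ordS (ordS i))))%type.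

Lemma card_stair i : #|stair_index i| = HN_mult i.
Proof. by rewrite card_sum !card_prod !card_ord. Qed.

Definition stair_mon i (s : stair_index i) : 'X_{1..3} :=
  match s with
  | inl p => (U_(ordS i) *+ p.1 + U_(ordS (ordS i)) *+ p.2)%MM
  | inr p => (U_(ordS i) *+ (b (ordS i) + p.1) + U_(ordS (ordS i)) *+ p.2)%MM
  end.

Definition stair (i : 'I_3) (m : 'X_{1..3}) : bool :=
  [&& m i == 0, m (ordS i) < c (ordS i), m (ordS (ordS i)) < c (ordS (ordS i)) &
      (m (ordS i) < b (ordS i)) || (m (ordS (ordS i)) < a (ordS (ordS i)))]%N.

Lemma stair_monE i (s : stair_index i) : (stair_mon s i = 0%N) *
  (stair_mon s (ordS i) = match s with inl p => val p.1 | inr p => (b (ordS i) + p.1)%N end) *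
  (stair_mon s (ordS (ordS i)) = match s with inl p => val p.2 | inr p => val p.2 end).
Proof.
by do !split; case: s => [[p1 p2]|[p1 p2]];
  rewrite mnmDE !mulmnE !(mnm1E, eqxx, ordS3_neq) /=; lia.
Qed.

Lemma stair_mon_stair i (s : stair_index i) : stair i (stair_mon s).
Proof.
rewrite /stair !stair_monE eqxx /=.
by case: s => [[p1 p2]|[p1 p2]] /=; have := ltn_ord p1; have := ltn_ord p2; lia.
Qed.

Lemma stairP i m : stair i m -> exists s : stair_index i, stair_mon s = m.
Proof.
case/and4P => /eqP mi mj ml mjl; have [ltj|gej] := ltnP (m (ordS i)) (b (ordS i)).
  exists (inl (Ordinal ltj, Ordinal ml)).
  by apply: (@mnm_ordS3P i); rewrite !stair_monE.
rewrite ltnNge gej /= in mjl.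
have ltj : (m (ordS i) - b (ordS i) < a (ordS i))%N by lia.
exists (inr (Ordinal ltj, Ordinal mjl)).
by apply: (@mnm_ordS3P i); rewrite !stair_monE //=; lia.
Qed.

Lemma stair_mon_inj i : injective (@stair_mon i).
Proof.
move=> s s' e; have := stair_monE s; rewrite e !stair_monE => -[[_ ]].
case: s s' {e} => [[p1 p2]|[p1 p2]] [[p1' p2']|[p1' p2']] /= e1 e2.
- by congr (inl (_, _)); apply: val_inj.
- by have := ltn_ord p1; lia.
- by have := ltn_ord p1'; lia.
- by congr (inr (_, _)); apply: val_inj => //=; lia.
Qed.

Lemma stair_down i (m m' : 'X_{1..3}) : stair i (m + m')%MM -> stair i m'.
Proof. by rewrite /stair !mnmDE; lia. Qed.

Hypotheses (a_gt0 : forall i, (0 < a i)%N) (b_gt0 : forall i, (0 < b i)%N).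

Lemma HN_mult_gt0 i : (0 < HN_mult i)%N.
Proof.
have := b_gt0 (ordS i); have := a_gt0 (ordS (ordS i)); rewrite /HN_mult; nia.
Qed.

(* (x_i) + I is a monomial ideal, and the staircase is the complement of its
   set of monomials. *)
Lemma stair_coef i f (s : stair_index i) :
  ideal_gen (('X_i : A) |` I) f -> f@_(stair_mon s) = 0.
Proof.
pose K := [set f : A | forall m, stair i m -> f@_m = 0].
have idK : is_ideal K.
  split=> [m _|f1 f2 K1 K2 m sm|f1 f2 K2 m sm].
  - by rewrite mcoeff0.
  - by rewrite mcoeffD K1 // K2 // addr0.
  rewrite mcoeffM big1 // => -[m1 m2] /= /eqP mE.
  by rewrite K2 ?mulr0 //; apply: (@stair_down i m1); rewrite -mE.
suff sub : ideal_gen (('X_i : A) |` I) `<=` K by move=> /sub; apply; apply: stair_mon_stair.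
apply: ideal_gen_sub => // g [->|] /=.
  move=> m /and4P[/eqP mi _ _ _]; rewrite mcoeffX; case: eqP => // me.
  by move: mi; rewrite -me mnm1E eqxx.
rewrite HN_idealE; move: g; apply: ideal_gen_sub => // _ [r _ <-] m.
rewrite mcoeffB !mcoeffX.
suff h m0 : (m0 = HN_lead r) \/ (m0 = HN_tail r) -> stair i m0 = false.
  case: eqP => [<-|_]; first by rewrite h //; left.
  case: eqP => [<-|_]; first by rewrite h //; right.
  by rewrite subrr.
have ir := ordS3_cases i r.
move=> me; apply/negbTE/negP; rewrite /stair => sm.
have ai := a_gt0 i; have bi := b_gt0 i.
by case: ir => re; case: me => me; move: sm;
  rewrite me {}re /HN_lead /HN_tail ?ordS3 ?mnmDE !mulmnE !(mnm1E, eqxx, ordS3_neq); lia.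
Qed.

Section Weights.
Variable w : 'I_3 -> nat.
Hypotheses (w_gt0 : forall i, (0 < w i)%N)
  (w_balance : forall i, (c i * w i =
     b (ordS i) * w (ordS i) + a (ordS (ordS i)) * w (ordS (ordS i)))%N).

Lemma wdeg_lead i : wdeg w (HN_lead i) = wdeg w (HN_tail i).
Proof. by rewrite wdegD !wdegMn !wdegU mulnC w_balance; lia. Qed.

Lemma wdeg_shift (u m m' : 'X_{1..3}) : (m <= u)%MM -> wdeg w m = wdeg w m' ->
  wdeg w (u - m + m')%MM = wdeg w u.
Proof. by move=> le_mu e; rewrite wdegD -e -wdegD submK. Qed.

Lemma whomog_HN_gen i : whomog w (wdeg w (HN_lead i)) (HN_gen i).
Proof. by apply: whomogB; [|rewrite wdeg_lead]; apply: whomogX. Qed.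

(* Rewriting with the three binomials towards higher powers of x_i preserves
   the weighted degree, hence terminates. *)
Lemma stair_reduce i u : exists t (s : stair_index i),
  I ('X_[u] - 'X_[(U_(i) *+ t + stair_mon s)%MM]) /\
  wdeg w (U_(i) *+ t + stair_mon s)%MM = wdeg w u.
Proof.
(* Induction on the weighted degree carried by the two variables other than x_i. *)
have [n] := ubnP (wdeg w u - w i * u i); elim: n u => // n IHn u; rewrite ltnS => le_n.
have step (m m' : 'X_{1..3}) : (m <= u)%MM -> (m i < m' i)%N -> I ('X_[m] - 'X_[m']) ->
    wdeg w m = wdeg w m' -> exists t (s : stair_index i),
    I ('X_[u] - 'X_[(U_(i) *+ t + stair_mon s)%MM]) /\
    wdeg w (U_(i) *+ t + stair_mon s)%MM = wdeg w u.
  move=> le_mu mi Im e; have [|t [s [It et]]] := IHn (u - m + m')%MM.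
    rewrite wdeg_shift // mnmDE mnmBE.
    have : (w i * (u i - m i + m' i) <= wdeg w u)%N.
      rewrite -(wdeg_shift le_mu e) /wdeg (bigD1 i) //= mnmDE mnmBE; lia.
    have := mnm_lepP le_mu i; have := w_gt0 i; nia.
  exists t, s; rewrite et wdeg_shift //; split=> //.
  by apply: (ideal_trans HN_is_ideal) It; apply: HN_shift.
have ai := a_gt0 i; have bi := b_gt0 i.
have [lej|ltj] := leqP (c (ordS i)) (u (ordS i)).
  apply: (step _ _ _ _ (HN_gen_in (ordS i)) (wdeg_lead _)).
    apply/mnm_lepP => r; rewrite /HN_lead mulmnE mnm1E.
    by case: eqP => [<-|_]; rewrite ?mul1n // mul0n.
  by rewrite /HN_lead /HN_tail mnmDE !mulmnE !(mnm1E, ordS3, eqxx, ordS3_neq); lia.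
have [lel|ltl] := leqP (c (ordS (ordS i))) (u (ordS (ordS i))).
  apply: (step _ _ _ _ (HN_gen_in (ordS (ordS i))) (wdeg_lead _)).
    apply/mnm_lepP => r; rewrite /HN_lead mulmnE mnm1E.
    by case: eqP => [<-|_]; rewrite ?mul1n // mul0n.
  by rewrite /HN_lead /HN_tail mnmDE !mulmnE !(mnm1E, ordS3, eqxx, ordS3_neq); lia.
(* Here the generator is used from tail to head, the other two having been used from head to tail:
   in each case the exponent of x_i goes up. *)
have [/andP[lej lel]|nle] := boolP
    ((b (ordS i) <= u (ordS i)) && (a (ordS (ordS i)) <= u (ordS (ordS i))))%N.
  apply: (step _ _ _ _ (idealBC HN_is_ideal (HN_gen_in i)) (esym (wdeg_lead i))).
  - apply/mnm_lepP => r; rewrite /HN_tail mnmDE !mulmnE !mnm1E.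
    case: (eqVneq (ordS i) r) => [<-|_]; first by rewrite !ordS3_neq; lia.
    by case: (eqVneq _ r) => [<-|_]; lia.
  - by rewrite /HN_lead /HN_tail mnmDE !mulmnE !(mnm1E, eqxx, ordS3_neq); lia.
(* No rule applies, so [u] stripped of its power of x_i lies in the staircase. *)
pose v := (u - U_(i) *+ u i)%MM.
have le_u : (U_(i) *+ u i <= u)%MM.
  apply/mnm_lepP => r; rewrite mulmnE mnm1E.
  by case: eqP => [<-|_]; rewrite ?mul1n // mul0n.
have /stairP [s sE] : stair i v.
  rewrite /stair /v !mnmBE !mulmnE !(mnm1E, eqxx, ordS3_neq); lia.
exists (u i), s; rewrite sE /v addmC submK //; split=> //.
by rewrite subrr; apply: (ideal0 HN_is_ideal).
Qed.

End Weights.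

End HN.

(** * The ideals K + (x^n) and bases modulo them *)

Section AddPower.
Variables (R : comPzRingType) (K : set R) (x : R).
Hypothesis idK : is_ideal K.

Definition add_power n : set R := [set f | exists h, K (f - x ^+ n * h)].

Lemma add_power_sub n : K `<=` add_power n.
Proof. by move=> f Kf; exists 0; rewrite mulr0 subr0. Qed.

Lemma add_power_mul n h : add_power n (x ^+ n * h).
Proof. by exists h; rewrite subrr; apply: ideal0. Qed.

Lemma add_power_ideal n : is_ideal (add_power n).
Proof.
split=> [|f g [h Kh] [h' Kh']|c f [h Kh]].
- by apply: add_power_sub; apply: ideal0.
- by exists (h + h'); rewrite mulrDr opprD addrACA; apply: idealD.
- by exists (c * h); rewrite mulrCA -mulrBr; apply: ideal_mull.
Qed.

Lemma add_powerS n f : add_power n f -> add_power n.+1 (x * f).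
Proof.
by move=> [h Kh]; exists h; rewrite exprS -mulrA -mulrBr; apply: ideal_mull.
Qed.

Lemma add_power_exp n f : add_power 1 f -> add_power n (f ^+ n).
Proof.
move=> [h Kh]; exists (h ^+ n); rewrite -exprMn subrXX.
by rewrite expr1 in Kh; apply: ideal_mulr.
Qed.

Lemma add_power_le n m : (m <= n)%N -> add_power n `<=` add_power m.
Proof.
move=> le_mn f [h Kh]; exists (x ^+ (n - m) * h).
by rewrite mulrA -exprD subnKC.
Qed.

Lemma ideal_gen_setU1 : ideal_gen (x |` K) = add_power 1.
Proof.
apply/seteqP; split.
  apply: ideal_gen_sub; first exact: add_power_ideal.
  move=> f [->|]; last exact: add_power_sub.
  by rewrite -[x]mulr1 -[X in X * 1]expr1; apply: add_power_mul.
move=> f [h Kh] J idJ subJ; have Jx : J x by apply: subJ; left.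
apply: (ideal_subl idJ (y := x * h)); last exact: ideal_mulr.
by apply: subJ; right; rewrite expr1 in Kh.
Qed.

End AddPower.

Section PowerBasis.
Variables (k : fieldType) (n : nat).
Local Notation A := {mpoly k[n]}.
Variables (q : set A) (x : A) (r : nat) (b : 'I_r -> A).
Hypotheses (prq : is_prime q) (qx : ~ q x).
Let idq : is_ideal q. Proof. by case: prq. Qed.

Definition power_basis N (p : 'I_N * 'I_r) : A := x ^+ p.1 * b p.2.

(** Modulo q, f is a combination of the b_s plus x g; expanding g modulo q + (x^N) supplies the
    terms with a positive power of x. *)
Lemma power_basis_spans N f : (forall f, spanned (add_power q x 1) b f) ->
  spanned (add_power q x N) (@power_basis N) f.
Proof.
move=> spb; elim: N f => [|N IHN] f.
  apply: spanned_ideal.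
  by rewrite -[f]mul1r; exact: add_power_mul.
have idN := add_power_ideal x idq N.+1.
have [c [g qg]] := spb f; rewrite expr1 in qg.
have -> : f = (f - \sum_s c s *: b s - x * g) + \sum_s c s *: b s + x * g.
  by rewrite addrAC !subrK.
apply: (spannedD idN); first apply: (spannedD idN).
- by apply: spanned_ideal; apply: add_power_sub.
- apply: (spanned_sum idN) => s _; apply: (spannedZ idN).
  apply: (spanned_mem (s := (ord0, s))).
  by rewrite /power_basis mul1r subrr; exact: ideal0 idN.
have [d Kd] := IHN g; rewrite -[g](subrK (\sum_s d s *: power_basis s)) mulrDr.
apply: (spannedD idN); first by apply: spanned_ideal; apply: add_powerS.
rewrite mulr_sumr; apply: (spanned_sum idN) => -[t s] _; rewrite -scalerAr.
apply: (spannedZ idN); apply: (spanned_mem (s := (lift ord0 t, s))).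
by rewrite /power_basis /= /bump leq0n add1n exprS -mulrA subrr; exact: ideal0 idN.
Qed.

(** Reduction modulo x kills the coefficients of the terms without x; the rest is divisible by x,
    which cancels because q is prime and does not contain x. *)
Lemma power_basis_indep N : independent (add_power q x 1) b ->
  independent (add_power q x N) (@power_basis N).
Proof.
move=> ib; elim: N => [|N IHN] c Kc [t s]; first by case: t.
pose c0 s := c (ord0, s); pose c1 (p : 'I_N * 'I_r) := c (lift ord0 p.1, p.2).
have E : \sum_p c p *: power_basis p =
  \sum_s c0 s *: b s + x * \sum_p c1 p *: power_basis p.
  rewrite (eq_bigr (fun p => c (p.1, p.2) *: power_basis (p.1, p.2))); last by case.
  rewrite -(pair_bigA _ (fun t s => c (t, s) *: power_basis (t, s))) big_ord_recl /=.
  congr (_ + _); first by apply: eq_bigr => u _; rewrite /power_basis mul1r.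
  rewrite pair_bigA mulr_sumr; apply: eq_bigr => -[t' s'] _ /=.
  by rewrite -scalerAr /power_basis /= /bump leq0n add1n exprS mulrA.
rewrite E in Kc.
have c00 : forall s, c0 s = 0.
  apply: ib; have id1 := add_power_ideal x idq 1.
  rewrite -[X in add_power _ _ _ X](addrK (x * \sum_p c1 p *: power_basis p)).
  apply: (idealB id1); first exact: (@add_power_le _ _ _ N.+1).
  by have := add_power_mul x idq 1 (\sum_p c1 p *: power_basis p); rewrite expr1.
have c10 : forall p, c1 p = 0.
  apply: IHN; case: Kc => h; rewrite big1 ?add0r; last by move=> u _; rewrite c00 scale0r.
  rewrite exprS -mulrA -mulrBr; case: prq => _ _ qM /qM [//|qh]; by exists h.
case: (unliftP ord0 t) => [t' ->|->]; last exact: c00.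
exact: (c10 (t', s)).
Qed.

End PowerBasis.

Lemma prime_mon (k : fieldType) (q : set {mpoly k[3]}) m : is_prime q ->
  (forall j, ~ q 'X_j) -> ~ q 'X_[m].
Proof.
move=> prq qX; have [_ q1 qM] := prq; rewrite mpolyXE_id.
by apply: (big_ind (fun f => ~ q f)) => [//|f g qf qg /qM []//|j _ /(primeX prq) /qX].
Qed.

(** * The vector m(I) and the minimal primes of an HN ideal *)

Section HNLength.
Variables (k : fieldType) (a b : 'I_3 -> nat).
Local Notation A := {mpoly k[3]}.
Local Notation I := (@HN_ideal k a b).
Local Notation c i := (a i + b i)%N.
Hypotheses (a_gt0 : forall i, (0 < a i)%N) (b_gt0 : forall i, (0 < b i)%N).

Section Over.
Variable q : set A.
Hypotheses (idq : is_ideal q) (Iq : I `<=` q).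

(** For j different from i, the generator with head a power of x_j has a tail divisible by x_i, so
    that power lies in q + (x_i); its n-th power lies in q + (x_i^n). *)
Lemma HN_nilpotent i n j : exists M, add_power q ('X_i : A) n ('X_j ^+ M).
Proof.
suff [M qM] : exists M, add_power q ('X_i : A) 1 ('X_j ^+ M).
  by exists (M * n)%N; rewrite exprM; apply: add_power_exp.
have xE s t : (0 < s)%N -> 'X_i ^+ s * t = 'X_i ^+ 1 * ('X_i ^+ s.-1 * t) :> A.
  by move=> s0; rewrite mulrA -exprD add1n prednK.
case: (ordS3_cases i j) => ->.
- exists 1%N; rewrite -[X in add_power _ _ _ X]mulr1; exact: add_power_mul.
- have := @HN_gen_in k a b (ordS i); rewrite /HN_gen /HN_lead /HN_tail ordS3 -mpolyXn => Ig.
  exists (c (ordS i)), ('X_i ^+ (a i).-1 * 'X_[(U_(ordS (ordS i)) *+ b (ordS (ordS i)))%MM]).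
  by rewrite -xE // [X in _ - X * _]mpolyXn -mpolyXD addmC; apply: Iq.
- have := @HN_gen_in k a b (ordS (ordS i)).
  rewrite /HN_gen /HN_lead /HN_tail !ordS3 -mpolyXn => Ig.
  exists (c (ordS (ordS i))), ('X_i ^+ (b i).-1 * 'X_[(U_(ordS i) *+ a (ordS i))%MM]).
  by rewrite -xE // [X in _ - X * _]mpolyXn -mpolyXD; apply: Iq.
Qed.

Lemma stair_spans i f :
  spanned (add_power q ('X_i : A) 1) (fun s : stair_index a b i => 'X_[stair_mon s]) f.
Proof.
have idx := add_power_ideal ('X_i : A) idq 1.
apply: (spanned_msupp idx) => m _.
have [[|t] [s [It _]]] := stair_reduce k a_gt0 b_gt0 (HN_mult_gt0 a_gt0 b_gt0)
    (@HN_mult_balance a b) i m.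
  apply: (spanned_mem (s := s)); apply: add_power_sub; apply: Iq.
  by rewrite (_ : stair_mon s = (U_(i) *+ 0 + stair_mon s)%MM) // mulm0n add0m.
apply: spanned_ideal; apply: (ideal_subl idx); first by apply: add_power_sub; apply: Iq It.
by rewrite mpolyXD -mpolyXn exprS -mulrA -[X in X * _]expr1; apply: add_power_mul.
Qed.

End Over.

(** The staircase monomials form a basis of A/(x_i A + I): they span by rewriting, and they are
    independent because no element of the ideal has a staircase monomial in its support. *)
Lemma HN_length i : is_length (('X_i : A) |` I) (HN_mult a b i).
Proof.
have idI := HN_is_ideal k a b.
have kerE : quot_pi (('X_i : A) |` I) @^-1` [set 0] = add_power I 'X_i 1.
  rewrite -ideal_gen_setU1 //; apply/seteqP; split=> f /=; by rewrite quot_pi_eq0.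
rewrite -card_stair.
apply: (length_basis (phi := quot_pi (('X_i : A) |` I))
  (b := fun s : stair_index a b i => 'X_[stair_mon s])).
- by move=> y; exists (repr y); apply/esym/quot_pi_repr.
- move=> j; have [M IM] := HN_nilpotent idI (@subset_refl _ I) i 1 j; exists M.
  by rewrite -kerE in IM.
- by move=> f; rewrite kerE; apply: stair_spans.
move=> d; rewrite kerE -ideal_gen_setU1 // => Kd s.
have := stair_coef a_gt0 b_gt0 s Kd; rewrite raddf_sum (bigD1 s) //=.
rewrite mcoeffZ mcoeffX eqxx mulr1 big1 ?addr0 // => t ts.
rewrite mcoeffZ mcoeffX; case: eqP => [/stair_mon_inj e|]; last by rewrite mulr0.
by rewrite e eqxx in ts.
Qed.

Lemma mvecE i : mvec I i = HN_mult a b i.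
Proof.
apply: longest_chain_unique (HN_length i).
by rewrite /mvec /length_quot; apply: (xgetPex 0%N); exists (HN_mult a b i); apply: HN_length.
Qed.

Section Weights.
Variable w : 'I_3 -> nat.
Hypotheses (w_gt0 : forall i, (0 < w i)%N)
  (w_balance : forall i, (c i * w i =
     b (ordS i) * w (ordS i) + a (ordS (ordS i)) * w (ordS (ordS i)))%N).

(** The kernel of x_i -> T^(w_i) is a prime containing I, inside m and free of variables; it serves
    to exclude m as a minimal prime. *)
Definition monomial_curve : A -> {poly k} :=
  mmap (@polyC k) (fun i => 'X^(w i)).

HB.instance Definition _ := GRing.RMorphism.on monomial_curve.

Lemma monomial_curveX m : monomial_curve 'X_[m] = 'X^(wdeg w m).
Proof.
rewrite /monomial_curve mmapX /mmap1; under eq_bigr do rewrite -exprM.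
by rewrite -expr_sum.
Qed.

Lemma monomial_curve_prime : is_prime (monomial_curve @^-1` [set 0]).
Proof.
apply: preimage_prime; split; first exact: is_ideal0.
  by move/eqP; rewrite oner_eq0.
by move=> x y /eqP; rewrite mulf_eq0 => /orP[] /eqP; [left|right].
Qed.

Lemma monomial_curve_HN : I `<=` monomial_curve @^-1` [set 0].
Proof.
rewrite HN_idealE; apply: ideal_gen_sub; first by case: monomial_curve_prime.
by move=> _ [i _ <-] /=; rewrite rmorphB /= !monomial_curveX wdeg_lead // subrr.
Qed.

Lemma monomial_curve_maxid : monomial_curve @^-1` [set 0] `<=` @maxid k.
Proof.
pose ev : {rmorphism A -> k} := horner_eval 0 \o monomial_curve.
have idev : is_ideal (ev @^-1` [set 0]) by apply/preimage_ideal/is_ideal0.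
have subev : @maxid k `<=` ev @^-1` [set 0].
  apply: ideal_gen_sub => // _ [i ->] /=.
  by rewrite monomial_curveX wdegU /horner_eval hornerXn expr0n gtn_eqF.
move=> f /= mf; apply/maxidP; have := subev _ (maxid_subC f).
rewrite /= /horner_eval rmorphB /= mf sub0r hornerN /monomial_curve mmapC hornerC.
by move/eqP; rewrite oppr_eq0 => /eqP.
Qed.

Section MinimalPrime.
Variable q : set A.
Hypothesis minq : minimal_primes I q.

Lemma HN_minimal_homog f : q f -> forall n, q (grading w f)`_n.
Proof.
apply: (minimal_prime_homog (HN_idealE k a b)) => // _ [i _ <-].
by exists (wdeg w (HN_lead a b i)); apply: whomog_HN_gen.
Qed.

(** A prime over I containing x_i contains a power of every variable, hence m, hence the kernel of
    [monomial_curve]. Minimality makes it equal to that kernel, which contains no variable. *)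
Lemma HN_minimal_X i : ~ q 'X_i.
Proof.
have [prq Iq qmin] := minq; have [idq _ _] := prq => qi.
have sub : @maxid k `<=` q.
  apply: ideal_gen_sub => // _ [j ->]; have [M [h qM]] := HN_nilpotent idq Iq i 1 j.
  apply: (primeX prq (n := M)); apply: (ideal_subl idq qM).
  by rewrite expr1; apply: ideal_mulr.
have := qmin _ monomial_curve_prime monomial_curve_HN (subset_trans monomial_curve_maxid sub).
move=> e; move: qi; rewrite -e /= monomial_curveX => /eqP.
by rewrite expf_eq0 polyX_eq0 andbF.
Qed.

(** The weights being positive, the component of degree 0 is the constant term; it lies in q and
    would be a unit if nonzero. *)
Lemma HN_minimal_maxid : q `<=` @maxid k.
Proof.
have [[idq q1 _] _ _] := minq => f qf; apply/maxidP.
have := HN_minimal_homog qf 0.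
have -> : (grading w f)`_0 = (f@_0%MM)%:MP.
  apply/mpolyP => m; rewrite coef_grading mcoeffC.
  have [->|m0] := eqVneq m 0%MM; first by rewrite wdeg0 mulr1.
  have [i mi] : exists i, m i != 0%N.
    apply/existsP; apply: contraNT m0; rewrite negb_exists => /forallP h.
    by apply/eqP/mnmP=> i; rewrite mnm0E; apply/eqP; rewrite -[_ == _]negbK.
  rewrite mulr0 /wdeg (bigD1 i) //= addn_eq0 muln_eq0 (negPf mi) gtn_eqF //.
move=> q0; apply/eqP; apply: contraT => f0; case: q1.
by apply: (idealZ_inv idq f0); rewrite -mul_mpolyC mulr1.
Qed.

End MinimalPrime.

End Weights.

End HNLength.

(** * Residues of degrees and the one-dimensional primes *)

Section Degrees.
Variable w : 'I_3 -> nat.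
Hypotheses (w_gt0 : forall i, (0 < w i)%N)
  (w_coprime : gcdn (gcdn (w ix1) (w ix2)) (w ix3) = 1%N).

(** The gcd of the other two weights is prime to [w i], so two Bézout relations reach every
    residue. *)
Lemma wdeg_mod_surj i n : exists u, (wdeg w u = n %[mod w i])%N.
Proof.
pose x := w (ordS i); pose y := w (ordS (ordS i)).
have co : coprime (gcdn x y) (w i).
  rewrite /coprime -w_coprime /x /y; have [s1 s2 s3] := ordS_ix.
  elim/ord3_ind: i {x y}; rewrite ?(s1, s2, s3) //; apply/eqP.
  - by rewrite gcdnC gcdnA.
  - by rewrite -gcdnA gcdnC.
have [x0 g0] : (0 < x /\ 0 < gcdn x y)%N by rewrite gcdn_gt0 /x w_gt0.
case: (egcdnP y x0) => s1 t1 e1 _; case: (egcdnP (w i) g0) => s2 t2 e2 _.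
rewrite (eqP co) in e2.
(* The relation s1 x - t1 y = gcd(x, y) has a negative coefficient; [(w i).-1] replaces -1 modulo
   [w i]. *)
exists (U_(ordS i) *+ (s1 * s2 * n) + U_(ordS (ordS i)) *+ (t1 * (w i).-1 * s2 * n))%MM.
rewrite wdegD !wdegMn !wdegU -/x -/y.
have -> : (x * (s1 * s2 * n) + y * (t1 * (w i).-1 * s2 * n) =
  n + (t2 * n + t1 * y * s2 * n) * w i)%N.
  have [v wE] : exists v, w i = v.+1 by exists (w i).-1; rewrite prednK.
  rewrite wE /= in e2 *.
  transitivity ((s1 * x) * (s2 * n) + y * (t1 * v * s2 * n))%N; first by ring.
  rewrite e1.
  transitivity ((s2 * gcdn x y) * n + t1 * y * v.+1 * s2 * n)%N; first by ring.
  by rewrite e2; ring.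
by rewrite addnC modnMDl.
Qed.

End Degrees.

Section HomogeneousPrime.
Variables (k : fieldType) (w : 'I_3 -> nat) (q : set {mpoly k[3]}).
Local Notation A := {mpoly k[3]}.
Hypotheses (w_gt0 : forall i, (0 < w i)%N)
  (w_coprime : gcdn (gcdn (w ix1) (w ix2)) (w ix3) = 1%N)
  (prq : is_prime q) (qX : forall j, ~ q 'X_j)
  (q_homog : forall f, q f -> forall n, q (grading w f)`_n).
Let idq : is_ideal q. Proof. by case: prq. Qed.

(* Monomials of minimal degree in the w_i residue classes modulo w_i (an Apéry
   set) stay independent modulo q + (x_i). *)
Lemma apery_indep i : exists u : 'I_(w i) -> 'X_{1..3},
  independent (add_power q ('X_i : A) 1) (fun t => 'X_[u t] : A).
Proof.
have uP (t : 'I_(w i)) : exists u, (wdeg w u = t %[mod w i])%N /\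
    forall u', (wdeg w u' = t %[mod w i])%N -> (wdeg w u <= wdeg w u')%N.
  pose P n := `[< exists2 u, wdeg w u = n & (n = t %[mod w i])%N >].
  have exP : exists n, P n.
    have [u ut] := wdeg_mod_surj w_gt0 w_coprime i t.
    by exists (wdeg w u); apply/asboolP; exists u.
  case: (ex_minnP exP) => n /asboolP [u <- ut] umin; exists u; split=> // u' ut'.
  by apply: umin; apply/asboolP; exists u'.
have [u uH] := boolp.choice uP; exists u => c [h qh] t.
have [ut umin] := uH t; pose D := wdeg w (u t).
(* In the component of degree [D] only the term of [t] survives, the other monomials having other
   residues. *)
have := q_homog qh D; rewrite rmorphB rmorphM raddf_sum /= coefB coef_sum.
rewrite (bigD1 t) //= big1 ?addr0 => [|s st]; last first.
  rewrite gradingZ gradingX coefCM coefCM coefXn; case: eqP => [e|]; last by rewrite !mulr0.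
  have [us _] := uH s; case/eqP: st; apply: val_inj; move: us.
  by rewrite -e ut !modn_small.
rewrite gradingZ gradingX !coefCM coefXn eqxx mulr1 mul_mpolyC.
(* A monomial of [h] in degree D - w_i would have the residue of [t] and a degree below the minimum
   [D]. *)
have -> : (grading w ('X_i ^+ 1) * grading w h)`_D = 0.
  rewrite expr1 gradingX wdegU -mulrA coefCM coefXnM; case: ltnP => [_|leD].
    by rewrite mulr0.
  rewrite (_ : _`_(D - w i) = 0) ?mulr0 //; apply/mpolyP => m.
  rewrite coef_grading mcoeff0; case: eqP => // mD.
  have := umin m; rewrite mD -/D; have : (D - w i = t %[mod w i])%N.
    by rewrite -ut -/D -{2}(subnK leD) modnDr.
  by move=> -> /(_ erefl); have := w_gt0 i; move: leD; clear; lia.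
rewrite subr0 => qc; apply/eqP; apply: contraT => c0.
by case: (prime_mon (m := u t) prq qX); apply: (idealZ_inv idq c0).
Qed.

End HomogeneousPrime.

(** Since p and x lie in m, the constant coefficient of a relation vanishes; then x cancels because
    p is prime and does not contain x. *)
Lemma poly_eval_indep (k : fieldType) (p : set {mpoly k[3]}) (x : {mpoly k[3]}) :
    is_prime p -> p `<=` @maxid k -> maxid x -> ~ p x ->
  forall N (c : 'I_N -> k), p (\sum_i c i *: x ^+ i) -> forall i, c i = 0.
Proof.
move=> [idp p1 pM] sub_pm mx px; elim=> [|N IHN] c pc i; first by case: i.
have c0 : c ord0 = 0.
  have := sub_pm _ pc; rewrite big_ord_recl expr0 => /maxidP.
  rewrite mcoeffD mcoeffZ mcoeff1 eqxx mulr1 => /eqP; rewrite addrC addr_eq0 => /eqP e.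
  apply/eqP; rewrite -oppr_eq0 -e; apply/eqP/maxidP.
  apply: (ideal_sum (@maxid_ideal k)) => j _; apply: (idealZ (@maxid_ideal k)).
  by rewrite /= /bump leq0n add1n exprS; apply: (ideal_mulr (@maxid_ideal k)).
case: (unliftP ord0 i) => [j ->|->]; last exact: c0.
apply: (IHN (fun j => c (lift ord0 j))) j; move: pc.
rewrite big_ord_recl c0 scale0r add0r.
rewrite (eq_bigr (fun j : 'I_N => x * (c (lift ord0 j) *: x ^+ j))) => [|j _].
  by rewrite -mulr_sumr => /pM [].
by rewrite /= /bump leq0n add1n exprS scalerAr.
Qed.

(** * No prime strictly between a minimal prime and the maximal ideal *)

Section Maximality.
Variables (k : fieldType) (a b : 'I_3 -> nat).
Local Notation A := {mpoly k[3]}.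
Local Notation I := (@HN_ideal k a b).
Hypotheses (a_gt0 : forall i, (0 < a i)%N) (b_gt0 : forall i, (0 < b i)%N).
Variables (q p : set A) (i : 'I_3).
Hypotheses (prq : is_prime q) (Iq : I `<=` q) (prp : is_prime p) (qp : q `<=` p)
  (pm : p `<=` @maxid k) (pX : ~ p 'X_i).
Local Notation w := (HN_mult a b).
Local Notation x := ('X_i : A).

(** Algebraic independence of f and x_i modulo q: modulo p only the terms without f remain, and
    independence of the powers of x_i kills them; then f cancels modulo q. *)
Lemma power_indep f : p f -> ~ q f -> forall N M (c : 'I_N -> 'I_M -> k),
  q (\sum_(s < N) f ^+ s * \sum_(t < M) c s t *: x ^+ t) -> forall s t, c s t = 0.
Proof.
move=> pf qf N M; have [idq _ qM] := prq; have [idp _ _] := prp.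
elim: N => [|N IHN] c qc s; first by case: s.
have c0 t : c ord0 t = 0.
  move: t; apply: (poly_eval_indep prp pm (@maxidX k i) pX).
  have := qp qc; rewrite big_ord_recl expr0 mul1r.
  set S := \sum_(j < N) _ => pc; rewrite -[X in p X](addrK S); apply: (idealB idp) => //.
  apply: (ideal_sum idp) => j _; rewrite /= /bump leq0n add1n exprS -mulrA.
  exact: (ideal_mulr idp).
case: (unliftP ord0 s) => [j ->|->]; last exact: c0.
apply: (IHN (fun j => c (lift ord0 j))) j; move: qc.
rewrite big_ord_recl [X in _ * X]big1 => [|t _]; last by rewrite c0 scale0r.
rewrite mulr0 add0r.
rewrite (eq_bigr (fun j : 'I_N => f * (f ^+ j * \sum_(t < M) c (lift ord0 j) t *: x ^+ t))).
  by rewrite -mulr_sumr => /qM [].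
by move=> j _; rewrite mulrA -exprS.
Qed.

(* Counting dimensions: the products f^s x_i^t with s <= m_i outnumber the
   monomials of their degree in normal form modulo I. *)
Lemma no_larger_prime : p `<=` q.
Proof.
move=> f pf; apply: contrapT => qf; have [idq _ _] := prq.
pose m := w i; pose D := size (grading w f).
(* [E] bounds the exponent of x_i in the normal forms of the products. The choice of [B] makes (m +
   1)(B + 1) exceed (E + 1)m by exactly one. *)
pose B := (m * m * D)%N; pose E := (m * D + B)%N.
pose e (s : 'I_E.+1 * stair_index a b i) : A := 'X_[(U_(i) *+ s.1 + stair_mon s.2)%MM].
pose t (s : 'I_m.+1 * 'I_B.+1) : A := f ^+ s.1 * x ^+ s.2.
have tsp s : spanned q e (t s).
  apply: (spanned_msupp idq) => v vs.
  have [T [s' [Iv vw]]] := stair_reduce k a_gt0 b_gt0 (HN_mult_gt0 a_gt0 b_gt0)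
    (@HN_mult_balance a b) i v.
  have size_t : (size (grading w (t s)) <= (m * D + w i * B).+1)%N.
    rewrite rmorphM !rmorphXn /= gradingX wdegU.
    have h1 := size_polyMleq (grading w f ^+ s.1) (((x%:P) * 'X^(w i)) ^+ s.2).
    have h2 := size_poly_exp_leq (grading w f) s.1.
    have h3 : (size (((x%:P) * 'X^(w i)) ^+ s.2) <= (w i * s.2).+1)%N.
      rewrite exprMn -exprM -rmorphXn /=; apply: (leq_trans (size_polyMleq _ _)).
      by rewrite size_polyXn addnS /= -[X in (_ <= X)%N]add1n leq_add2r size_polyC_leq1.
    rewrite -/D in h2.
    have h4 : (D.-1 * s.1 <= m * D)%N.
      by rewrite mulnC leq_mul // ?leq_pred // -ltnS ltn_ord.
    have h5 : (w i * s.2 <= w i * B)%N by rewrite leq_mul // -ltnS ltn_ord.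
    rewrite (leq_trans h1) // -subn1 (leq_trans (leq_sub2r 1 (leq_add h2 h3))) //.
    by move: h4 h5; clear; lia.
  have ltT : (T < E.+1)%N.
    have := msupp_wdeg w vs; rewrite -vw wdegD wdegMn wdegU.
    have := HN_mult_gt0 a_gt0 b_gt0 i; have := size_t; rewrite /E -/m; nia.
  by apply: (spanned_mem (s := (Ordinal ltT, s'))); apply: Iq.
have tind : independent q t.
  move=> c qc [s s']; apply: (power_indep pf qf (c := fun s s' => c (s, s'))).
  rewrite (eq_bigr (fun s => \sum_s' c (s, s') *: t (s, s'))) => [|u _].
    by rewrite pair_bigA /= (eq_bigr (fun p => c p *: t p)) // => -[].
  by rewrite mulr_sumr; apply: eq_bigr => u' _; rewrite -scalerAr.
have := dim_le idq tsp tind; rewrite !card_prod !card_ord card_stair -/m /E /B.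
suff cnt (M L : nat) :
  ((M.+1 * (M * M * L).+1 <= (M * L + M * M * L).+1 * M) = false)%N by rewrite cnt.
by clear; nia.
Qed.

End Maximality.

(** * The local ring of a prime at the origin *)

Section FractionIdeal.
Variables (k : fieldType) (R : comPzRingType).
Local Notation A := {mpoly k[3]}.
Variables (phi : {rmorphism A -> R}) (K : set A).

(** The extension of K to a ring of fractions with denominators outside m; it serves for A_m with K
    = q and for A_m/q_m with K = m. *)
Lemma fraction_ideal : is_ideal K ->
    (forall y, exists f g, ~ maxid g /\ y * phi g = phi f) ->
  is_ideal [set y | exists f g, [/\ K f, ~ maxid g & y * phi g = phi f]].
Proof.
move=> idK frac.
have addE (y z f1 g1 f2 g2 : R) : y * g1 = f1 -> z * g2 = f2 ->
  (y + z) * (g1 * g2) = f1 * g2 + f2 * g1 by move=> <- <-; ring.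
have mulE (y z f1 g1 f2 g2 : R) : y * g1 = f1 -> z * g2 = f2 ->
  (y * z) * (g1 * g2) = f1 * f2 by move=> <- <-; ring.
split=> [|y z [f1 [g1 [q1 m1 e1]]] [f2 [g2 [q2 m2 e2]]]|y z [f1 [g1 [q1 m1 e1]]]].
- exists 0, 1; split; [exact: ideal0| |by rewrite mul0r rmorph0].
  by have [_ + _] := @maxid_prime k.
- exists (f1 * g2 + f2 * g1), (g1 * g2); split; last first.
  + by rewrite rmorphD !rmorphM; apply: addE.
  + exact: maxidM.
  + by apply: (idealD idK); apply: (ideal_mulr idK).
have [f2 [g2 [m2 e2]]] := frac y; exists (f2 * f1), (g2 * g1); split.
- exact: ideal_mull.
- exact: maxidM.
- by rewrite !rmorphM; apply: mulE.
Qed.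

End FractionIdeal.

Section LocalRing.
Variable k : fieldType.
Local Notation A := {mpoly k[3]}.

Lemma to_locA_zmod_morphism : zmod_morphism (@to_locA k).
Proof. by move=> f g; apply: val_inj; rewrite rmorphB /= tofracB. Qed.

Lemma to_locA_monoid_morphism : monoid_morphism (@to_locA k).
Proof.
by split=> [|f g]; apply: val_inj; rewrite ?rmorph1 ?rmorphM /= ?tofrac1 ?tofracM.
Qed.

HB.instance Definition _ :=
  GRing.isZmodMorphism.Build A (locA k) (@to_locA k) to_locA_zmod_morphism.
HB.instance Definition _ :=
  GRing.isMonoidMorphism.Build A (locA k) (@to_locA k) to_locA_monoid_morphism.

Lemma to_locA_inj : injective (@to_locA k).
Proof. by move=> f g /(congr1 val) /= /eqP; rewrite tofrac_eq => /eqP. Qed.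

Lemma locA_frac (y : locA k) : exists f g : A, ~ maxid g /\ y * to_locA g = to_locA f.
Proof.
have /in_locAP [f [g [mg yE]]] := valP y; exists f, g; split=> //.
by apply: val_inj; rewrite rmorphM /= yE divfK // maxid_neq0.
Qed.

Lemma locA_unit (g : A) : ~ maxid g -> exists y, y * to_locA g = 1.
Proof.
move=> mg; have yP : (FracField.tofrac 1 / FracField.tofrac g)%R \in @in_locA k.
  by apply/in_locAP; exists 1, g.
exists (LocA yP); apply: val_inj.
exact: etrans (divfK (maxid_neq0 mg) _) (tofrac1 _).
Qed.

Variable q : set A.
Hypotheses (prq : is_prime q) (qm : q `<=` @maxid k).
Let idq : is_ideal q. Proof. by case: prq. Qed.
Local Notation R := (local_quot q).
Local Notation psi := (@to_local_quot k q).

HB.instance Definition _ := GRing.RMorphism.copy psi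
  (quot_pi (@to_locA k @` q) \o @to_locA k).

(** Elements of q A_m are fractions with numerator in q, and denominators outside m are outside q,
    so q A_m contracts to q. *)
Lemma local_quot_eq0 f : psi f = 0 <-> q f.
Proof.
rewrite /to_local_quot quot_pi_eq0; split=> [gf|qf]; last by apply: sub_ideal_gen; exists f.
pose K := [set y | exists f g, [/\ q f, ~ maxid g & y * to_locA g = to_locA f]].
have idK : is_ideal K := fraction_ideal idq locA_frac.
have [|f1 [g1 [q1 m1 e1]]] := gf K idK.
  move=> _ [f1 q1 <-]; exists f1, 1; split=> //; last by rewrite rmorph1 mulr1.
  by have [_ + _] := @maxid_prime k.
move: e1; rewrite -rmorphM => /to_locA_inj e1.
by have [_ _ qM] := prq; case: (qM f g1) => [|//|/qm]; first rewrite e1.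
Qed.

Lemma local_quot_frac (y : R) : exists f g : A, ~ maxid g /\ y * psi g = psi f.
Proof.
rewrite -(quot_pi_repr y); have [f [g [mg e]]] := locA_frac (repr y).
by exists f, g; split=> //; rewrite /to_local_quot -e rmorphM.
Qed.

Lemma local_quot_unit (g : A) : ~ maxid g -> exists y : R, y * psi g = 1.
Proof.
move=> /locA_unit [y e]; exists (quot_pi _ y).
by rewrite /to_local_quot -rmorphM e rmorph1.
Qed.

Lemma local_quot_ideal_frac (K : set R) y f g : is_ideal K -> ~ maxid g ->
  y * psi g = psi f -> K (psi f) <-> K y.
Proof.
move=> idK mg e; split=> [Kf|Ky]; last by rewrite -e; apply: ideal_mulr.
have [z ze] := local_quot_unit mg.
by rewrite -[y]mul1r -ze -mulrA [psi g * y]mulrC e; apply: ideal_mull.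
Qed.

Lemma local_quot_prime0 : is_prime [set 0 : R].
Proof.
have [_ _ qM] := prq; split; first exact: is_ideal0.
  by rewrite /= -(rmorph1 psi) => /local_quot_eq0; case: prq.
move=> y z /= yz; have [f [g [mg e]]] := local_quot_frac y.
have [f' [g' [mg' e']]] := local_quot_frac z.
have : q (f * f').
  by apply/local_quot_eq0; rewrite rmorphM /= -e -e' mulrACA yz mul0r.
have id0 := is_ideal0 R.
case/qM => /local_quot_eq0 f0; [left|right].
- exact/(local_quot_ideal_frac id0 mg e).
- exact/(local_quot_ideal_frac id0 mg' e').
Qed.

Definition local_maxid : set R :=
  [set y | exists f g, [/\ maxid f, ~ maxid g & y * psi g = psi f]].

Lemma local_maxidP f : local_maxid (psi f) <-> maxid f.
Proof.
have [idm m1 mM] := @maxid_prime k.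
split=> [[f' [g [mf' mg e]]]|mf]; last by exists f, 1; split=> //; rewrite rmorph1 mulr1.
have qfg : q (f * g - f') by apply/local_quot_eq0; rewrite rmorphB rmorphM /= e subrr.
by have /mM [] : maxid (f * g) by apply: (ideal_subl idm (qm qfg)).
Qed.

Lemma local_maxid_prime : is_prime local_maxid.
Proof.
have [idm m1 mM] := @maxid_prime k.
have idM : is_ideal local_maxid := fraction_ideal idm local_quot_frac.
split=> //; first by rewrite -(rmorph1 psi) => /local_maxidP.
move=> y z yz; have [f [g [mg e]]] := local_quot_frac y.
have [f' [g' [mg' e']]] := local_quot_frac z.
have : local_maxid (psi (f * f')).
  by rewrite rmorphM /= -e -e' mulrACA; apply: ideal_mulr.
move/local_maxidP => /mM [] /local_maxidP h; [left|right].
- exact/(local_quot_ideal_frac idM mg e).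
- exact/(local_quot_ideal_frac idM mg' e').
Qed.

(** Primes of A_m/q_m pull back to primes between q and m; [between] leaves only the two ends, and
    [x] shows that they differ. *)
Lemma local_quot_dim1 (x : A) : maxid x -> ~ q x ->
    (forall p, is_prime p -> q `<=` p -> p `<=` @maxid k -> ~ p `<=` q -> @maxid k `<=` p) ->
  is_krull_dim R 1.
Proof.
move=> mx qx between; split.
  exists (fun n => if n is 0 then [set 0] else local_maxid); split=> [[|n] _|[|//] _].
  - exact: local_quot_prime0.
  - exact: local_maxid_prime.
  split=> [y ->|]; first by case: local_maxid_prime => -[].
  by move=> /(_ (psi x)) h; apply/qx/local_quot_eq0/h/local_maxidP.
move=> n [C [prC ltC]]; rewrite leqNgt; apply/negP => n2.
have [pr0 pr1 pr2] := And3 (prC 0%N isT) (prC 1%N (ltnW n2)) (prC 2%N n2).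
have [[id0 _ _] [id1 C1 _] [id2 C2 _]] := And3 pr0 pr1 pr2.
(* In a longer chain the middle prime pulls back to m, so an element of the next prime outside it
   would have a unit as numerator. *)
pose p : set A := psi @^-1` C 1%N.
have pm : p `<=` @maxid k.
  move=> g pg; apply: contrapT => mg; have [y ye] := local_quot_unit mg.
  by apply: C1; rewrite -ye; apply: ideal_mull.
have mp : @maxid k `<=` p.
  apply: between => //; first exact: preimage_prime.
    by move=> f /local_quot_eq0 f0; rewrite /p /= f0; apply: ideal0.
  have [sub01 nsub01] := ltC 0%N (ltnW n2).
  move=> pq; apply: nsub01 => y; have [f [g [mg e]]] := local_quot_frac y.
  move=> /(local_quot_ideal_frac id1 mg e) pf.
  apply/(local_quot_ideal_frac id0 mg e); rewrite (_ : psi f = 0); first exact: ideal0.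
  exact/local_quot_eq0/pq.
have [sub12 nsub12] := ltC 1%N n2; apply: nsub12 => y.
have [f [g [mg e]]] := local_quot_frac y.
move=> /(local_quot_ideal_frac id2 mg e) pf; apply/(local_quot_ideal_frac id1 mg e).
apply/mp; apply: contrapT => mf; have [z ze] := local_quot_unit mf.
by apply: C2; rewrite -ze; apply: ideal_mull.
Qed.

Section PowerLength.
Variables (x : A) (n : nat).
Local Notation J := (ideal_gen [set psi x]).
Local Notation P := (ideal_pow J n).

Lemma ideal_powE (y : R) : ideal_gen P y <-> exists z, y = z * psi x ^+ n.
Proof.
have genJ y' : J y' -> exists z, y' = z * psi x.
  apply: (ideal_gen_sub (K := [set y' | exists z, y' = z * psi x])) => [|_ ->].
    split=> [|u v [z ->] [z' ->]|u v [z ->]].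
    - by exists 0; rewrite mul0r.
    - by exists (z + z'); rewrite mulrDl.
    - by exists (u * z); rewrite mulrA.
  by exists 1; rewrite mul1r.
rewrite ideal_gen_id; last exact: ideal_gen_ideal.
split=> [|[z ->]].
  apply: (ideal_gen_sub (K := [set y | exists z, y = z * psi x ^+ n])) => [|_ [f Jf ->]].
    split=> [|u v [z ->] [z' ->]|u v [z ->]].
    - by exists 0; rewrite mul0r.
    - by exists (z + z'); rewrite mulrDl.
    - by exists (u * z); rewrite mulrA.
  have /boolp.choice [g gE] := fun i => genJ _ (Jf i).
  exists (\prod_i g i).
  by rewrite (eq_bigr _ (fun i _ => gE i)) big_split prodr_const card_ord.
apply: (ideal_mull (ideal_gen_ideal _)); apply: sub_ideal_gen.
exists (fun=> psi x); last by rewrite prodr_const card_ord.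
by move=> _; apply: sub_ideal_gen.
Qed.

Local Notation phi := (quot_pi P \o psi).

(** Elements outside m are already invertible modulo q + (x^n), which contains a power of each
    variable. Denominators can therefore be removed, and A/(q + (x^n)) is the local quotient:
    injectivity here, surjectivity next. *)
Lemma local_power_ker : (forall j, exists M, add_power q x n ('X_j ^+ M)) ->
  phi @^-1` [set 0] = add_power q x n.
Proof.
move=> nil; have idx := add_power_ideal x idq n.
apply/seteqP; split=> f /=; rewrite quot_pi_eq0 ideal_powE.
  move=> [z fE]; have [h [g [mg e]]] := local_quot_frac z.
  have qfg : q (f * g - x ^+ n * h).
    apply/local_quot_eq0; rewrite rmorphB !rmorphM rmorphXn /= -e fE.
    by rewrite mulrAC [psi x ^+ n * _]mulrC subrr.
  have [g' gg'] := unit_mod_primary idx nil mg.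
  have afg : add_power q x n (f * g * g') by apply: (ideal_mulr idx); exists h.
  have -> : f = f * g * g' - f * (g * g' - 1) by rewrite mulrBr mulr1 mulrA subKr.
  by apply: (idealB idx) => //; apply: (ideal_mull idx).
move=> [h /local_quot_eq0]; rewrite rmorphB rmorphM rmorphXn /= => /eqP.
by rewrite subr_eq0 => /eqP ->; exists (psi h); rewrite mulrC.
Qed.

Lemma local_power_surj : (forall j, exists M, add_power q x n ('X_j ^+ M)) ->
  forall y, exists f, y = phi f.
Proof.
move=> nil y; have idx := add_power_ideal x idq n.
have [f [g [mg e]]] := local_quot_frac (repr y).
have [g' gg'] := unit_mod_primary idx nil mg; exists (f * g') => /=.
rewrite -(quot_pi_repr y) rmorphM /= -e -mulrA -rmorphM /=.
apply/quot_pi_eq/ideal_powE; have [h /local_quot_eq0] := gg'.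
rewrite rmorphB rmorphM rmorphXn /= => /eqP; rewrite subr_eq0 rmorphB rmorph1 => /eqP e'.
exists (- (repr y * psi h)); rewrite mulNr -mulrA [psi h * _]mulrC -e'.
by rewrite mulrBr mulr1 opprB.
Qed.

Lemma local_power_length (S : finType) (b : S -> A) :
    (forall j, exists M, add_power q x n ('X_j ^+ M)) ->
    (forall f, spanned (add_power q x n) b f) -> independent (add_power q x n) b ->
  is_length P #|S|.
Proof.
move=> nil spb ib; have kerE := local_power_ker nil.
apply: (length_basis (phi := phi) (b := b)); rewrite ?kerE //.
  exact: local_power_surj.
by move=> j; have [M qM] := nil j; exists M; rewrite -kerE in qM.
Qed.

End PowerLength.

(* The elements x^s b_t with s < n form a basis of R / x^n R, so its length is r n. *)
Lemma local_multiplicity (x : A) r (b : 'I_r -> A) :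
    is_krull_dim R 1 -> ~ q x -> (0 < r)%N ->
    (forall n j, exists M, add_power q x n ('X_j ^+ M)) ->
    (forall f, spanned (add_power q x 1) b f) -> independent (add_power q x 1) b ->
  multiplicity (ideal_gen [set psi x]) = r%:R.
Proof.
move=> dim1 qx r0 nil spb ib; set J := ideal_gen _.
have len n : is_length (ideal_pow J n) (r * n)%N.
  rewrite mulnC -[n in (n * _)%N]card_ord -[r]card_ord -card_prod.
  apply: (local_power_length (nil n)) => [f|].
  - exact: power_basis_spans.
  - exact: (power_basis_indep prq qx).
have multr : is_multiplicity J r%:R.
  (* The length is r n for every n, so the polynomial is r X, valid from n = 0 on. *)
  exists 1%N, (r%:R *: 'X), 0%N.
  have rn0 : r%:R != 0 :> rat by rewrite pnatr_eq0 -lt0n.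
  split=> //; first by rewrite size_scale // size_polyX.
    by move=> n _; exists (r * n)%N; rewrite // hornerZ hornerX natrM.
  by rewrite lead_coefZ lead_coefX mulr1 mul1r.
(* [multiplicity] is some admissible value; its polynomial agrees with r X at all large integers,
   hence equals it. *)
have := xgetPex 0 (ex_intro _ _ multr); rewrite -/(multiplicity J).
move: (multiplicity J) => e [d [P [N [dimd sizeP PE ->]]]].
have d1 : d = 1%N := longest_chain_unique dimd dim1.
suff -> : P = r%:R *: 'X by rewrite d1 lead_coefZ lead_coefX mulr1 mul1r.
apply/eqP; rewrite -subr_eq0; apply/eqP.
apply: (@roots_geq_poly_eq0 _ _ [seq (N + i)%:R | i <- iota 0 (size (P - r%:R *: 'X)).+1]).
- apply/allP => _ /mapP [i _ ->]; rewrite rootE !hornerE.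
  have [l lenl ->] := PE (N + i)%N (leq_addr _ _).
  by rewrite (longest_chain_unique lenl (len _)) natrM subrr.
- rewrite map_inj_uniq ?iota_uniq // => i j /eqP.
  by rewrite eqr_nat eqn_add2l => /eqP.
- by rewrite size_map size_iota.
Qed.

End LocalRing.

(** * Counting the minimal primes *)

Section Count.
Variables (k : fieldType) (a b : 'I_3 -> nat) (w : 'I_3 -> nat).
Local Notation A := {mpoly k[3]}.
Local Notation I := (@HN_ideal k a b).
Hypotheses (a_gt0 : forall i, (0 < a i)%N) (b_gt0 : forall i, (0 < b i)%N)
  (w_gt0 : forall i, (0 < w i)%N)
  (w_balance : forall i, ((a i + b i) * w i =
     b (ordS i) * w (ordS i) + a (ordS (ordS i)) * w (ordS (ordS i)))%N)
  (w_coprime : gcdn (gcdn (w ix1) (w ix2)) (w ix3) = 1%N).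

(** Here r is the dimension of A/(q + x_i A), bounded below by the number of independent Apéry
    monomials. *)
Lemma HN_mult_x (q : set A) i : minimal_primes I q ->
  exists2 r, mult_x i q = r%:R & (w i <= r)%N.
Proof.
move=> minq; have [prq Iq qmin] := minq; have [idq _ _] := prq.
have qX := HN_minimal_X a_gt0 b_gt0 w_gt0 w_balance minq.
have q_homog := HN_minimal_homog w_balance minq.
have qm := HN_minimal_maxid w_gt0 w_balance minq.
have idx := add_power_ideal ('X_i : A) idq 1.
have [r [f [spf indf]]] := exists_basis idx (stair_spans a_gt0 b_gt0 idq Iq i).
have le_r : (w i <= r)%N.
  have [u indu] := apery_indep w_gt0 w_coprime prq qX q_homog i.
  by have := dim_le idx (fun j => spf _) indu; rewrite !card_ord.
exists r => //; apply: (local_multiplicity prq qm (b := f)) => //.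
- apply: (local_quot_dim1 prq qm (@maxidX k i) (qX i)) => p prp qp pm npq.
  have pX j : p 'X_j.
    apply: contrapT => pj; apply: npq.
    exact: (no_larger_prime a_gt0 b_gt0 prq Iq prp qp pm pj).
  by apply: ideal_gen_sub => [|_ [j ->] //]; case: prp.
- exact: leq_trans (w_gt0 i) le_r.
- by move=> n j; apply: (HN_nilpotent a_gt0 b_gt0 idq Iq).
Qed.

Section Family.
Variables (N : nat) (Q : 'I_N -> set A).
Hypotheses (Q_inj : injective Q) (Q_min : forall l, minimal_primes I (Q l)).

(** For distinct indices, minimality gives an element of [Q l'] outside [Q l], and one of its
    homogeneous components is still outside [Q l]. The product over all [l'] separates [l] from the
    rest. *)
Lemma separating_homog : exists (f : 'I_N -> A) (D : 'I_N -> nat),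
  [/\ forall l, whomog w (D l) (f l), forall l l', l' != l -> Q l' (f l)
    & forall l, ~ Q l (f l)].
Proof.
have sep (ll : 'I_N * 'I_N) : exists hn : A * nat,
    [/\ whomog w hn.2 hn.1, ll.2 != ll.1 -> Q ll.2 hn.1 & ~ Q ll.1 hn.1].
  case: ll => l l' /=; have [prl Il lmin] := Q_min l.
  have [->|ll'] := eqVneq l' l.
    by exists (1, 0%N); split=> //=; [exact: whomogC|case: prl].
  have /existsNP [h /not_implyP [Ql'h Qlh]] : ~ Q l' `<=` Q l.
    have [prl' Il' _] := Q_min l'.
    by move=> /(lmin _ prl' Il') /Q_inj e; rewrite e eqxx in ll'.
  have [n Qln] : exists n, ~ Q l (grading w h)`_n.
    apply/existsNP => Qall; apply: Qlh; rewrite -(sum_grading w h).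
    by case: prl => idl _ _; apply: (ideal_sum idl).
  exists ((grading w h)`_n, n); split=> //= [|_]; first exact: whomog_grading.
  exact: (HN_minimal_homog w_balance (Q_min l')).
have [hn hnP] := boolp.choice sep.
exists (fun l => \prod_l' (hn (l, l')).1), (fun l => \sum_l' (hn (l, l')).2)%N; split.
- by move=> l; apply: whomog_prod => l' _; have [] := hnP (l, l').
- move=> l l' ll'; have [[idl' _ _] _ _] := Q_min l'.
  by apply: (ideal_prod idl' (t := l')); have [_ + _] := hnP (l, l'); apply.
- move=> l; have [[_ Q1 QM] _ _] := Q_min l.
  apply: (big_ind (fun h => ~ Q l h)) => // [x y Qx Qy /QM [] //|l' _].
  by have [] := hnP (l, l').
Qed.

(** Every residue class modulo [w i] contains the degrees of at least [N] staircase monomials;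
    summing over the classes gives the bound. *)
Lemma minimal_primes_count i : (N * w i <= HN_mult a b i)%N.
Proof.
have [f [D [fD Qf Qlf]]] := separating_homog.
pose cls (s : stair_index a b i) : 'I_(w i) :=
  Ordinal (ltn_pmod (wdeg w (stair_mon s)) (w_gt0 i)).
have N_le (t : 'I_(w i)) : (N <= #|[pred s | cls s == t]|)%N.
  have /boolp.choice [u uP] : forall l, exists u, (D l + wdeg w u = t %[mod w i])%N.
    (* The multiple [D l * (w i).-1] replaces - D_l modulo [w i]. *)
    move=> l; have [u ut] := wdeg_mod_surj w_gt0 w_coprime i (t + D l * (w i).-1).
    exists u; rewrite -modnDmr ut modnDmr addnCA -mulnS prednK //.
    by rewrite addnC modnMDl.
  (* A common degree in the class of [t], large enough for all [l]; a power of x_i fills the gap, a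
     multiple of [w i]. *)
  pose n := (t + (\sum_l (D l + wdeg w (u l))) * w i)%N.
  have /boolp.choice [v vP] : forall l, exists v, (D l + wdeg w v = n)%N.
    move=> l; have le_n : (D l + wdeg w (u l) <= n)%N.
      rewrite /n (bigD1 l) //=; have := w_gt0 i; nia.
    have /dvdnP [z zE] : (w i %| n - (D l + wdeg w (u l)))%N.
      by rewrite -eqn_mod_dvd // /n addnC modnMDl uP.
    exists (u l + U_(i) *+ z)%MM; rewrite wdegD wdegMn wdegU mulnC -zE; lia.
  pose S := {s : stair_index a b i | cls s == t}.
  (* In degree [n] the staircase monomial determines the power of x_i in a normal form. *)
  pose e (s : S) : A :=
    'X_[(U_(i) *+ ((n - wdeg w (stair_mon (val s))) %/ w i) + stair_mon (val s))%MM].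
  pose g l := f l * 'X_[v l].
  have idI := HN_is_ideal k a b.
  have gsp l : spanned I e (g l).
    apply: (spanned_msupp idI) => m mg.
    have mn : wdeg w m = n.
      by rewrite -(vP l); apply: whomog_msupp mg; apply/whomogM/whomogX.
    have [T [s [Is sw]]] := stair_reduce k a_gt0 b_gt0 w_gt0 w_balance i m.
    rewrite wdegD wdegMn wdegU mn in sw.
    have st : cls s == t.
      by rewrite -val_eqE /= -(modn_small (ltn_ord t))
        -(modnMDl (\sum_l (D l + wdeg w (u l))) t) addnC -/n -sw mulnC modnMDl.
    apply: (spanned_mem (s := (Sub s st : S))); rewrite /e SubK -sw addnK mulKn //.
  (* Modulo [Q l] a relation reduces to its [l]-th term, and neither [f l] nor a monomial lies in
     [Q l]. *)
  have gind : independent I g.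
    move=> c Ic l; have [[idl _ QM] Il _] := Q_min l.
    apply/eqP; apply: contraT => cl; have := Il _ Ic; rewrite (bigD1 l) //=.
    set r := \sum_(_ | _) _ => Qs.
    have Qr : Q l r.
      apply: (ideal_sum idl) => l' ll'; apply: (idealZ idl); apply: (ideal_mulr idl).
      by apply: Qf; rewrite eq_sym.
    have := idealB idl Qs Qr; rewrite addrK => /(idealZ_inv idl cl) /QM [/Qlf //|].
    have [prl _ _] := Q_min l; move=> QX; case: (prime_mon prl _ QX) => j.
    exact: (HN_minimal_X a_gt0 b_gt0 w_gt0 w_balance (Q_min l)).
  by have := dim_le idI gsp gind; rewrite card_ord card_sig.
have -> : (N * w i = \sum_(t < w i) N)%N by rewrite sum_nat_const card_ord mulnC.
rewrite -card_stair -sum1_card (partition_big cls predT) //=; apply: leq_sum => t _.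
by rewrite sum1_card; apply: N_le.
Qed.

End Family.

End Count.

(** * From bounded families to a cardinality, and the two inequalities *)

(** An infinite X would receive an injection from d + 1 points; so X is finite, and an enumeration
    of it is itself a bounded family. *)
Lemma card_le_of_injections (T : pointedType) (X : set T) (d : nat) :
    (forall n (f : 'I_n -> T), injective f -> (forall i, X (f i)) -> (n <= d)%N) ->
  exists2 n : nat, (X #= `I_n)%card & (n <= d)%N.
Proof.
move=> inj_le; have le_d n : (`I_n #<= X)%card -> (n <= d)%N.
  move=> /pcard_leP [g]; pose f (i : 'I_n) : T := g i.
  have f_inj : injective f.
    move=> i j gij.
    by apply/val_inj/(@inj _ _ _ g); rewrite ?inE //= ltn_ord.
  by apply: (inj_le n f f_inj) => i; apply: funS; rewrite /= ltn_ord.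
have [n Xn] : finite_set X.
  apply/finite_setPn => natX.
  have /le_d := card_le_trans (subset_card_le (@subsetT _ `I_d.+1)) natX.
  by rewrite ltnn.
by exists n => //; apply: le_d; move: Xn; rewrite card_eq_le => /andP [].
Qed.

Theorem theorem8p3 (k : fieldType) (I : set {mpoly k[3]}) (hI : is_HN I) :
  let m := mvec I in
  let d := gcdn (gcdn (m ix1) (m ix2)) (m ix3) in
  let s := minn (gcdn (m ix1) (m ix2))
             (minn (gcdn (m ix1) (m ix3)) (gcdn (m ix2) (m ix3))) in
  (forall q, minimal_primes I q ->
     forall i j : 'I_3, i != j ->
       (m i)%:R / (gcdn (m i) (m j))%:R <= mult_x i q)
  /\
  (exists2 N : nat, (minimal_primes I #= `I_N)%card &
     N%:R <= 1 + s%:R * (d%:R - 1) / d%:R :> rat).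
Proof.
case: hI => a [b [a_gt0 b_gt0 ->]] m d s.
have mE : m = HN_mult a b by apply/funext => i; apply: mvecE.
have m_gt0 i : (0 < m i)%N by rewrite mE; apply: HN_mult_gt0.
have d_gt0 : (0 < d)%N by rewrite !gcdn_gt0 m_gt0.
have d_dvd i : (d %| m i)%N.
  elim/ord3_ind: i; rewrite /d; [| |exact: dvdn_gcdr].
  - exact: dvdn_trans (dvdn_gcdl _ _) (dvdn_gcdl _ _).
  - exact: dvdn_trans (dvdn_gcdl _ _) (dvdn_gcdr _ _).
(* Division by [d] keeps the balance relations and makes the weights coprime. *)
pose w i := (m i %/ d)%N; have dw i : m i = (d * w i)%N by rewrite mulnC divnK.
have w_gt0 i : (0 < w i)%N by rewrite divn_gt0 // dvdn_leq.
have w_balance i : ((a i + b i) * w i =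
    b (ordS i) * w (ordS i) + a (ordS (ordS i)) * w (ordS (ordS i)))%N.
  apply/eqP; rewrite -(eqn_pmul2l d_gt0) mulnDr !(mulnCA d) -!dw mE.
  exact/eqP/HN_mult_balance.
have w_coprime : gcdn (gcdn (w ix1) (w ix2)) (w ix3) = 1%N.
  by apply/eqP; rewrite -(eqn_pmul2l d_gt0) !muln_gcdr -!dw muln1.
have d_le i j : (d <= gcdn (m i) (m j))%N.
  by apply: dvdn_leq; rewrite ?gcdn_gt0 ?m_gt0 // dvdn_gcd !d_dvd.
split=> [q minq i j _|].
  have [r -> le_r] := HN_mult_x a_gt0 b_gt0 w_gt0 w_balance w_coprime i minq.
  (* Since d is at most gcd(m_i, m_j), one has m_i = d w_i <= r gcd(m_i, m_j). *)
  rewrite ler_pdivrMr ?ltr0n ?gcdn_gt0 ?m_gt0 // -natrM ler_nat {1}dw mulnC.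
  exact: leq_mul.
have [n f f_inj f_min|N minN le_N] :=
  @card_le_of_injections _ (minimal_primes (@HN_ideal k a b)) d.
  have := minimal_primes_count a_gt0 b_gt0 w_gt0 w_balance w_coprime f_inj f_min ix1.
  by rewrite -mE dw leq_pmul2r.
exists N => //.
have d_le_s : (d <= s)%N by rewrite !leq_min !d_le.
have dn0 : d%:R != 0 :> rat by rewrite pnatr_eq0 -lt0n.
(* The intermediate term is d - 1 = d(d - 1)/d, and d is at most s. *)
rewrite -lerBlDl; apply: (@le_trans _ _ (d%:R * (d%:R - 1) / d%:R)).
  by rewrite mulrAC divff // mul1r lerD2r ler_nat.
apply: ler_wpM2r; first by rewrite invr_ge0 ler0n.
apply: ler_wpM2r; first by rewrite subr_ge0 ler1n.
by rewrite ler_nat.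
Qed.
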